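(* Let $D$ be an almost positive diagram of a knot $K$, with negative crossing $p$. Let $s(K)$ be the Rasmussen invariant of $K$, and let $g_{3}(D)$ be the genus of the Seifert surface obtained from $D$ by Seifert's algorithm. (1) If there is no (positive) crossing of $D$ joining the same two Seifert circles of $D$ as the two circles which are connected by the negative crossing $p$, then $s(K)=2g_{3}(D)$. (2) If there is a (positive) crossing of $D$ joining the same two Seifert circles of $D$ as the two circles which are connected by the negative crossing $p$, then $s(K)=2g_{3}(D)-2$.
   Context: Knots are oriented knots in $S^3$. An oriented link diagram is almost positive if it has exactly one negative crossing (all its other crossings are positive); the knot represented by such a diagram is allowed to be positive. The Seifert circles of $D$ are the circles obtained by smoothing all crossings of $D$ according to the orientation. Each crossing of $D$ connects (joins) two distinct Seifert circles. Seifert's algorithm gives the surface formed by disks bounded by the Seifert circles, joined by one half-twisted band for each crossing. $s(K)$ is Rasmussen's invariant (an even integer) defined from Lee's deformation of rational Khovanov homology. Namely, replace the multiplication and comultiplication on $V=\mathbf{Q}\langle 1,X\rangle$ ($\deg 1=1$, $\deg X=-1$) in the Khovanov complex of a diagram of $K$ by $m'(1\otimes 1)=1$, $m'(1\otimes X)=m'(X\otimes 1)=X$, $m'(X\otimes X)=1$, $\Delta'(1)=1\otimes X+X\otimes 1$, $\Delta'(X)=X\otimes X+1\otimes 1$. The resulting complex is filtered by the (normalized) $q$-grading, and its homology for a knot is $2$-dimensional over $\mathbf{Q}$, concentrated in homological degree $0$. The grading of a nonzero homology class is the maximum over its representative cycles of the minimal $q$-degree of the homogeneous components of the representative. The maximum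 and minimum of these gradings over nonzero classes are $s(K)+1$ and $s(K)-1$, which defines $s(K)$. With this convention the positive (right-handed) trefoil has $s=2$. *)

(* Defs.v *)
From HB Require Import structures.
From mathcomp Require Import all_boot all_order all_fingroup all_algebra.
Set Implicit Arguments.
Unset Strict Implicit.
Unset Printing Implicit Defensive.
Import Order.TTheory GRing.Theory Num.Theory.
Local Open Scope ring_scope.

(* Signed oriented Gauss codes.  The crossings are 0, ..., ncross - 1.  The
   passage (c, o) is the overpassing (o = true) or underpassing (o = false)
   oriented strand at the crossing c; after (c, o), travelling along the link,
   the next passage is [next_passage (c, o)].  Components without crossings are not
   represented. *)
Record gauss_code := GaussCode {
  ncross : nat;
  positive : {ffun 'I_ncross -> bool};
  next_passage : {perm 'I_ncross * bool}
}.

(* The passage (c, o) has two ends: ((c, o), false), where the strand enters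
   the crossing, and ((c, o), true), where it leaves it. *)
Notation dart D := ('I_(ncross D) * bool * bool)%type.

Section Diagrams.
Variable D : gauss_code.
Implicit Types (c : 'I_(ncross D)) (x y : dart D).

Definition edge x : dart D :=
  let: (v, out) := x in
  if out then (next_passage D v, false) else ((next_passage D)^-1%g v, true).

(* Counterclockwise order of the four ends around a crossing:
     positive:  over-out, under-out, over-in,  under-in;
     negative:  under-out, over-out, under-in, over-in.  *)
Definition rot_ccw x : dart D :=
  let: (c, o, out) := x in
  (c, ~~ o, if o == positive D c then out else ~~ out).

Definition face x : dart D := rot_ccw (edge x).

(* The code is that of a knot diagram on the sphere: one component, and Euler
   characteristic V - E + F = 2, where V = ncross and E = 2 * ncross.  The
   underlying 4-valent graph is connected since there is one component. *)
Definition knot_diagram : Prop :=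
  #|porbits (next_passage D)| = 1%N /\ fcard face predT = (ncross D).+2.

Definition almost_positive (p : 'I_(ncross D)) : Prop :=
  ~~ positive D p /\ forall c, c != p -> positive D c.

Definition oriented_arc x : dart D :=
  let: (c, o, out) := x in (c, ~~ o, ~~ out).
Definition unoriented_arc x : dart D :=
  let: (c, o, out) := x in (c, ~~ o, out).

(* A vertex v of the cube of resolutions: v c = false for the 0-smoothing
   (A-smoothing) of c, and v c = true for the 1-smoothing.  The 0-smoothing is
   the oriented one exactly at the positive crossings. *)
Notation state := {ffun 'I_(ncross D) -> bool}.
Implicit Type v : state.

Definition arc v x : dart D :=
  if v x.1.1 == ~~ positive D x.1.1 then oriented_arc x else unoriented_arc x.

Definition smoothing_rel v : rel (dart D) :=
  fun x y => (y == edge x) || (y == arc v x).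

Definition circle v x : {set dart D} := [set y | connect (smoothing_rel v) x y].

Definition circles v : {set {set dart D}} := [set circle v x | x : dart D].

Definition oriented_state : state := [ffun c => ~~ positive D c].

Definition seifert_circles : {set {set dart D}} := circles oriented_state.

(* The two arcs at c of any smoothing contain one end of the overstrand each. *)
Definition circles_at v c : {set {set dart D}} :=
  [set circle v (c, true, true); circle v (c, true, false)].

Definition joins_same_seifert_circles c c' : Prop :=
  circles_at oriented_state c = circles_at oriented_state c'.

(* Disks minus bands. *)
Definition seifert_euler : int := #|seifert_circles|%:Z - (ncross D)%:Z.

(* The Seifert surface of a knot diagram is connected with one boundary
   component, so that its Euler characteristic is 1 - 2 * genus. *)
Definition seifert_genus : int := ((1 - seifert_euler) %/ 2)%Z.

(* The basis 1, X of V is encoded by bool. *)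
Local Notation V1 := false.
Local Notation VX := true.

(* m' maps basis vectors to basis vectors. *)
Definition lee_mul (a b : bool) : bool :=
  match a, b with
  | V1, V1 => V1
  | V1, VX => VX
  | VX, V1 => VX
  | VX, VX => V1
  end.

(* Delta' maps a basis vector to the sum of the listed a (x) b. *)
Definition lee_comul (a : bool) : seq (bool * bool) :=
  match a with
  | V1 => [:: (V1, VX); (VX, V1)]
  | VX => [:: (VX, VX); (V1, V1)]
  end.

(* The tensor product of the copies of V over the circles of v has as basis the
   labellings of these circles by 1 and X, encoded as functions on darts which
   are constant on each circle. *)
Definition is_labelling (s : state * {ffun dart D -> bool}) : bool :=
  [forall x, forall y, smoothing_rel s.1 x y ==> (s.2 x == s.2 y)].

Definition generator := {s : state * {ffun dart D -> bool} | is_labelling s}.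

Definition gstate (s : generator) : state := (val s).1.
Definition glabel (s : generator) : {ffun dart D -> bool} := (val s).2.

Definition ncircles_labelled (s : generator) (a : bool) : nat :=
  #|[set circle (gstate s) x | x : dart D & glabel s x == a]|.

Definition qdeg (s : generator) : int :=
  (ncircles_labelled s V1)%:Z - (ncircles_labelled s VX)%:Z
  + #|[set c | gstate s c]|%:Z
  + #|[set c | positive D c]|%:Z - 2 * #|[set c | ~~ positive D c]|%:Z.

(* v' is obtained from v by changing the smoothing at c from 0 to 1. *)
Definition cube_edge v c (v' : state) : bool :=
  ~~ v c && [forall i, v' i == (v i || (i == c))].

Definition cube_sign v c : rat :=
  (-1) ^+ #|[set i : 'I_(ncross D) | (i < c)%N & v i]|.

Definition lee_local c (s t : generator) : bool :=
  let a := (c, true, true) in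
  let b := (c, true, false) in
  [forall x, (x \in circle (gstate s) a) || (x \in circle (gstate s) b)
             || (glabel t x == glabel s x)] &&
  (if circle (gstate s) a == circle (gstate s) b
   then (glabel t a, glabel t b) \in lee_comul (glabel s a)
   else glabel t a == lee_mul (glabel s a) (glabel s b)).

(* Coefficient of t in the image of s. *)
Definition lee_coef (s t : generator) : rat :=
  \sum_(c | cube_edge (gstate s) c (gstate t))
    cube_sign (gstate s) c * (lee_local c s t)%:R.

(* The direct sum of the chain groups of all homological degrees.  The
   q-filtration is compatible with this sum, so the total homology has the same
   nonzero classes and gradings when the homology is in degree 0. *)
Notation chain := {ffun generator -> rat}.

Definition lee_d (z : chain) : chain :=
  [ffun t => \sum_s lee_coef s t * z s].

Definition nonzero_class (z : chain) : Prop :=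
  lee_d z = 0 /\ ~ (exists y : chain, z = lee_d y).

(* q is the minimal degree of the homogeneous components of z. *)
Definition min_qdeg (z : chain) (q : int) : Prop :=
  (exists2 s, z s != 0 & qdeg s = q) /\ (forall s, z s != 0 -> q <= qdeg s).

(* q is the grading of the homology class of z. *)
Definition class_grading (z : chain) (q : int) : Prop :=
  (exists y : chain, min_qdeg (z + lee_d y) q) /\
  (forall (y : chain) q', min_qdeg (z + lee_d y) q' -> q' <= q).

(* s + 1 is the maximum and s - 1 the minimum of the gradings of the nonzero
   homology classes; this determines s. *)
Definition is_rasmussen_invariant (s : int) : Prop :=
  [/\ exists2 z, nonzero_class z & class_grading z (s + 1),
      exists2 z, nonzero_class z & class_grading z (s - 1) &
      forall z q, nonzero_class z -> class_grading z q -> s - 1 <= q <= s + 1].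

End Diagrams.

(* Main.v *)
From HB Require Import structures.
Require Import Defs.
From mathcomp Require Import all_boot all_order all_fingroup all_algebra.
From mathcomp Require Import zify ring lra.
Set Implicit Arguments.
Unset Strict Implicit.
Unset Printing Implicit Defensive.
Import Order.TTheory GRing.Theory Num.Theory.
Local Open Scope ring_scope.

(** Let n be the number of crossings, O the number of Seifert circles and
    L = n - O - 2 = 2 g - 3 the degree of the generator X...X of the oriented state.
    The only state below the oriented one in the cube of resolutions is the
    all-0 state, obtained by changing the smoothing of the negative crossing p; it
    has a single circle M in place of the two Seifert circles A and B at p.
    Boundaries in degree 0 thus come from chains y at this state, and all
    gradings can be read off from a few coefficients of such boundaries.

    The homology is spanned by two canonical cycles at the oriented state
    ([cycle_comb_span], [cycle_comb_boundary]).  Their sum S and difference T are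
    supported on the labellings with an even and an odd number of labels 1, so that S
    starts in degree L and T in degree L + 2 ([cycle_combE]).  Multiplication by X on a
    circle commutes with the differential, lowers degrees by at most 2 and exchanges
    S and T up to sign, so that one upper bound on a grading gives both
    ([rasmussen_criterion]).

    If a positive crossing c joins A and B, then both p and c split M.  The
    coefficients of the boundary of y at the two generators X...X above the all-0 state
    are both the coefficient of X...X in y.  The one at c must vanish, and
    hence S cannot be lifted above degree L ([low_class_parallel]): s - 1 = L.

    Otherwise every other crossing merges two circles of the all-0 state.  A
    multiple of X...X there cancels the lowest term of S, and since X times X is 1
    all the remaining terms of S have degree at least L + 4 ([corrected_high]).
    The class of T cannot be lifted above L + 2: a boundary has equal coefficients at
    the generators with one label 1, on A or on B, because the comultiplication of 1
    is symmetric, whereas those of T are opposite because A and B meet at a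
    crossing ([low_class_not_parallel]): s - 1 = L + 2.

    Planarity enters only through Gauss's parity condition ([gauss_parity]): it
    makes every change of smoothing a merge or a split ([separated_flip]) and
    makes the canonical labelling constant on the Seifert circles.  Lee's theorem is
    proved by evaluating the tensor powers of Q[X]/(X^2 - 1) at sign vectors
    ([fourier_lee]): after this change of basis the complex is a direct sum of
    cubes, indexed by the labellings of the edges by signs, and a cube is acyclic
    unless it is a point ([to_cube_lee], [contractionP]). *)

Notation dart D := ('I_(ncross D) * bool * bool)%type.
Notation passage D := ('I_(ncross D) * bool)%type.
Notation state D := {ffun 'I_(ncross D) -> bool}.
(* The arcs of a smoothing, not those of a cyclic sequence. *)
Notation arc := Defs.arc.

(** * Diagrams and checkerboard colourings *)

Section Planarity.
Variable D : gauss_code.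
Implicit Types (x y : dart D) (u : passage D).

Lemma edgeK : involutive (@edge D).
Proof. by case=> u [] /=; rewrite ?permK ?permKV. Qed.

Lemma rot_ccw_inj : injective (@rot_ccw D).
Proof.
move=> [[c o] out] [[c' o'] out'] [<-] /negb_inj <-.
by case: (o == _) => [<-|/negb_inj <-].
Qed.

Lemma face_inj : injective (@face D).
Proof. exact: inj_comp rot_ccw_inj (inv_inj edgeK). Qed.

Lemma passage_ind (hK : #|porbits (next_passage D)| = 1%N)
    (P : passage D -> Prop) u0 :
  P u0 -> (forall u, P u -> P (next_passage D u)) -> forall u, P u.
Proof.
move=> P0 Pn u.
have /eqP/cards1P[O defO] := hK.
have mem w : porbit (next_passage D) w = O.
  by apply/set1P; rewrite -defO imset_f.
have /porbitP[i ->] : u \in porbit (next_passage D) u0.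
  by rewrite -eq_porbit_mem !mem.
elim: i => [|i IH]; first by rewrite perm1.
by rewrite expgSr permM; apply: Pn.
Qed.

Definition face_colourings : {set {ffun dart D -> bool}} :=
  [set f : {ffun dart D -> bool} | [forall x, f (face x) == f x]].

Lemma face_colouringP (f : {ffun dart D -> bool}) :
  reflect (forall x, f (face x) = f x) (f \in face_colourings).
Proof.
by rewrite inE; apply: (iffP forallP) => h x; apply/eqP; rewrite ?h.
Qed.

Lemma card_face_colourings : (2 ^ fcard (@face D) predT <= #|face_colourings|)%N.
Proof.
pose roots := [set x : dart D | froots (@face D) x].
have -> : fcard (@face D) predT = #|roots|.
  by apply: eq_card => x; rewrite !inE andbT.
rewrite -card_powerset.
pose col (S : {set dart D}) := [ffun x => froot (@face D) x \in S].
have <- : #|col @: powerset roots| = #|powerset roots|.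
  apply: card_in_imset => S S'; rewrite !inE => sS sS' /ffunP eS.
  apply/setP=> x; case: (boolP (froots (@face D) x)) => [/eqP rx | nrx].
    by have := eS x; rewrite !ffunE rx.
  have out (T : {set dart D}) : T \subset roots -> (x \in T) = false.
    by move=> sT; apply: contraNF nrx => /(subsetP sT); rewrite inE.
  by rewrite !out.
apply: subset_leq_card; apply/subsetP => _ /imsetP[S _ ->].
apply/face_colouringP => x; rewrite !ffunE.
suff -> : froot (@face D) (face x) = froot (@face D) x by [].
apply/esym/eqP; rewrite (root_connect (fconnect_sym face_inj)).
exact: fconnect1.
Qed.

Lemma rot_ccw_colouring f x :
  f \in face_colourings -> f (rot_ccw x) = f (edge x).
Proof. by move/face_colouringP=> hf; rewrite -[x in LHS]edgeK hf. Qed.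

(** The coboundary of a face colouring. *)
Definition jump (f : {ffun dart D -> bool}) x := f x (+) f (edge x).

Lemma jump_edge f x : jump f (edge x) = jump f x.
Proof. by rewrite /jump edgeK addbC. Qed.

(** The jumps at the four ends around a crossing add up to zero, since
    each of the four corners is counted twice. *)
Lemma jump_crossing f c :
  f \in face_colourings ->
  jump f (c, true, true) (+) jump f (c, true, false)
  = jump f (c, false, true) (+) jump f (c, false, false).
Proof.
move=> hf; rewrite /jump -!rot_ccw_colouring //=.
by case: (positive D c) => /=; move: (f (c, _, _)) (f (c, _, _))
  (f (c, _, _)) (f (c, _, _)) => [] [] [] [].
Qed.

(** For a knot these bits determine a face colouring: the jumps are carried along
    the knot from one edge, and one colour then fixes all the others. *)
Definition strand_jumps u0 (f : {ffun dart D -> bool}) :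
    bool * bool * {ffun 'I_(ncross D) -> bool} :=
  (f (u0, true), jump f (u0, true),
   [ffun c => jump f (c, true, true) (+) jump f (c, true, false)]).

(** By [jump_crossing] a constant jump along the overstrands forces one along
    the understrands, and the knot visits every edge. *)
Lemma strand_jump_const (hK : #|porbits (next_passage D)| = 1%N) u0 f :
  f \in face_colourings ->
  (forall c, jump f (c, true, true) (+) jump f (c, true, false) = false) ->
  forall x, jump f x = jump f (u0, true).
Proof.
move=> hf h0; have h u : jump f (u, true) = jump f (u, false).
  case: u => c []; apply/eqP; rewrite -negb_add ?h0 //.
  by rewrite -jump_crossing // h0.
suff ht u : jump f (u, true) = jump f (u0, true).
  by case=> u []; rewrite -?h ht.
apply: (passage_ind hK (u0 := u0)
          (P := fun u => jump f (u, true) = jump f (u0, true))) => // w <-.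
by rewrite h -[(_, false)]/(edge (w, true)) jump_edge.
Qed.
Lemma strand_jumps_inj (hK : #|porbits (next_passage D)| = 1%N) u0 :
  {in face_colourings &, injective (strand_jumps u0)}.
Proof.
move=> f g hf hg [e0 e1 /ffunP e2].
pose h := [ffun x => f x (+) g x].
have hh : h \in face_colourings.
  move/face_colouringP: hf => hf; move/face_colouringP: hg => hg.
  by apply/face_colouringP => x; rewrite !ffunE hf hg.
have jh x : jump h x = jump f x (+) jump g x.
  by rewrite /jump !ffunE addbACA.
have h0 c : jump h (c, true, true) (+) jump h (c, true, false) = false.
  by have := e2 c; rewrite !ffunE !jh addbACA => ->; rewrite addbb.
have he x : h (edge x) = h x.
  have := strand_jump_const hK u0 hh h0 x.
  by rewrite [in RHS]jh e1 addbb => /negbT; rewrite negb_add => /eqP.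
(* The difference h does not jump, so it is constant around each crossing and along
   each edge. *)
have hr x : h (rot_ccw x) = h x by rewrite rot_ccw_colouring.
have hs u : h (u, true) = h (u, false).
  case: u => c o.
  have := hr (c, o, true); have := hr (c, o, false).
  rewrite -[X in X = h (c, o, false) -> _]hr -[X in X = h (c, o, true) -> _]hr /=.
  have := hr (c, ~~ o, true); have := hr (c, ~~ o, false).
  rewrite /= !negbK.
  have := hr (c, o, true); have := hr (c, o, false); rewrite /=.
  by case: (positive D c) (o) => [] [] /=; do 4?[move=> ->|move=> <-].
have hc u : h (u, true) = false.
  apply: (passage_ind hK (u0 := u0) (P := fun u => h (u, true) = false)) => [|w <-].
    by rewrite !ffunE e0 addbb.
  by rewrite hs -[(_, false)]/(edge (w, true)) he.
apply/ffunP => -[u b]; apply/eqP; rewrite -negb_add.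
have -> : f (u, b) (+) g (u, b) = h (u, b) by rewrite ffunE.
by case: b; rewrite -?hs hc.
Qed.

(** By Euler's formula there are as many face colourings as there are values
    of [strand_jumps], so some face colouring jumps across every edge: this is
    the checkerboard colouring.  The colour on one fixed side of the strand
    then alternates along the knot and differs for the two strands of a
    crossing, which is Gauss's parity condition. *)
Lemma gauss_parity (hD : knot_diagram D) :
  exists phi : passage D -> bool,
    (forall u, phi (next_passage D u) = ~~ phi u) /\
    (forall c o, phi (c, ~~ o) = ~~ phi (c, o)).
Proof.
case: hD => hK hF; case: (posnP (ncross D)) => [n0 | n0].
  have no (c : 'I_(ncross D)) : False by have := ltn_ord c; rewrite [X in (_ < X)%N]n0.
  by exists (fun=> true); split=> [[c _]|c]; case: (no c).
pose u0 : passage D := (Ordinal n0, true).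
have surj : strand_jumps u0 @: face_colourings = setT.
  apply/eqP; rewrite eqEcard subsetT /= card_in_imset; last first.
    exact: strand_jumps_inj.
  apply: leq_trans card_face_colourings.
  by rewrite hF cardsT !card_prod card_bool card_ffun card_bool card_ord !expnS mulnA.
have /imsetP[f hf [_ f1 /ffunP f2]] :
    (false, true, [ffun=> false]) \in strand_jumps u0 @: face_colourings.
  by rewrite surj.
have fe x : f (edge x) = ~~ f x.
  have /(strand_jump_const hK u0 hf)/(_ x) : forall c,
      jump f (c, true, true) (+) jump f (c, true, false) = false.
    by move=> c; have := f2 c; rewrite !ffunE.
  by rewrite -f1 /jump; case: (f x) (f _) => [] [].
have fr x : f (rot_ccw x) = ~~ f x by rewrite rot_ccw_colouring.
have fx c o out out' : f (c, ~~ o, out') = ~~ f (c, o, out).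
  case: (boolP (out' == (if o == positive D c then out else ~~ out))) => [/eqP ->|].
    exact: fr (c, o, out).
  move=> h; have := fr (c, ~~ o, out'); rewrite /= negbK.
  move/(congr1 negb); rewrite negbK => <-; congr (~~ f (_, _, _)).
  by move: h; case: (positive D c) (o) (out) (out') => [] [] [] [].
exists (fun u => f (u, true)); split=> [u | c o]; last exact: fx.
rewrite -[~~ f (u, true)]fe /=; case: (next_passage D u) => c o.
by apply: negb_inj; rewrite -(fx c o true true) -(fx c o false true).
Qed.

End Planarity.
(** * Circles of a state *)

Section Circles.
Variable D : gauss_code.
Implicit Types (c : 'I_(ncross D)) (x y : dart D) (u : passage D).
Implicit Types (v : state D) (P Q : pred (dart D)).

Definition over_out c : dart D := (c, true, true).
Definition over_in c : dart D := (c, true, false).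

Definition flip_state v c : state D := [ffun i => v i (+) (i == c)].

Lemma flip_stateK c : involutive (flip_state^~ c).
Proof. by move=> v; apply/ffunP => i; rewrite !ffunE addbK. Qed.

Lemma flip_stateC v c c' :
  flip_state (flip_state v c) c' = flip_state (flip_state v c') c.
Proof. by apply/ffunP => i; rewrite !ffunE addbAC. Qed.

Lemma flip_state_at v c : flip_state v c c = ~~ v c.
Proof. by rewrite ffunE eqxx addbT. Qed.

Lemma flip_state_neq v c i : i != c -> flip_state v c i = v i.
Proof. by rewrite ffunE => /negbTE ->; rewrite addbF. Qed.

Lemma arcE v c o out :
  arc v (c, o, out) = (c, ~~ o, out (+) (v c == ~~ positive D c)).
Proof. by rewrite /arc /=; case: eqP => _ /=; rewrite ?addbT ?addbF. Qed.

Lemma arcK v : involutive (arc v).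
Proof. by move=> [[c o] out]; rewrite !arcE negbK addbK. Qed.

Lemma arc_flip v c x : x.1.1 != c -> arc (flip_state v c) x = arc v x.
Proof. by case: x => [[i o] out] /= h; rewrite !arcE flip_state_neq. Qed.

Lemma smoothing_connect_sym v : connect_sym (smoothing_rel v).
Proof.
apply: sym_connect_sym => x y; rewrite /smoothing_rel.
congr (_ || _); rewrite eq_sym; first exact: inv_eq (@edgeK D) _ _.
exact: inv_eq (arcK v) _ _.
Qed.

Lemma mem_circle v x y : (y \in circle v x) = connect (smoothing_rel v) x y.
Proof. by rewrite inE. Qed.

Lemma circle_id v x : x \in circle v x.
Proof. by rewrite mem_circle. Qed.

Lemma eq_circle v x y : (circle v x == circle v y) = (y \in circle v x).
Proof.
apply/eqP/idP => [-> | ]; first exact: circle_id.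
rewrite mem_circle => xy; apply/setP => z.
by rewrite !mem_circle; apply: same_connect => //; apply: smoothing_connect_sym.
Qed.

Lemma circle_eq v x y : y \in circle v x -> circle v y = circle v x.
Proof. by rewrite -eq_circle => /eqP. Qed.

Lemma circle_edge v x : circle v (edge x) = circle v x.
Proof.
by apply/circle_eq; rewrite mem_circle connect1 // /smoothing_rel eqxx.
Qed.

Lemma circle_arc v x : circle v (arc v x) = circle v x.
Proof.
by apply/circle_eq; rewrite mem_circle connect1 // /smoothing_rel eqxx orbT.
Qed.

Definition labelling v P :=
  (forall x, P (edge x) = P x) /\ (forall x, P (arc v x) = P x).

Lemma is_labellingP v (f : {ffun dart D -> bool}) :
  reflect (labelling v f) (is_labelling (v, f)).
Proof.
apply: (iffP forallP) => [h | [he ha] x].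
  split=> x; have /forallP h' := h x.
    by have /implyP/(_ _)/eqP-> := h' (edge x); rewrite ?/smoothing_rel ?eqxx.
  by have /implyP/(_ _)/eqP-> := h' (arc v x); rewrite ?/smoothing_rel ?eqxx ?orbT.
apply/forallP => y; apply/implyP => /orP[]/eqP -> /=; first by rewrite he.
by rewrite ha.
Qed.

Lemma labelling_circle v P x y : labelling v P -> y \in circle v x -> P y = P x.
Proof.
move=> [he ha]; rewrite mem_circle => /connectP[p].
elim: p x => [x _ -> // | z p IH x /= /andP[xz pz] ly].
by rewrite (IH z) //; case/orP: xz => /eqP ->.
Qed.

Lemma circle_sub v P x :
  (forall y, P y -> P (edge y)) -> (forall y, P y -> P (arc v y)) ->
  P x -> forall y, y \in circle v x -> P y.
Proof.
move=> he ha Px y yx.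
suff L : labelling v P by rewrite (labelling_circle L yx).
split=> z.
  by apply/idP/idP => [/he|/he //]; rewrite edgeK.
by apply/idP/idP => [/ha|/ha //]; rewrite arcK.
Qed.

Lemma labelling_in_circle v x : labelling v (mem (circle v x)).
Proof.
by split=> y; rewrite inE /= -!eq_circle (circle_edge, circle_arc).
Qed.

(** ** Changing the smoothing of one crossing *)

Definition circles_near v c := circle v (over_out c) :|: circle v (over_in c).

Definition separated v c := circle v (over_out c) != circle v (over_in c).

Lemma circles_nearE v c x :
  (x \in circles_near v c) =
  (x \in circle v (over_out c)) || (x \in circle v (over_in c)).
Proof. by rewrite inE. Qed.

Lemma ends_near v c x : x.1.1 = c -> x \in circles_near v c.
Proof.
case: x => [[i o] out] /= ->; rewrite circles_nearE -!eq_circle.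
case: o; first by case: out; rewrite eqxx ?orbT.
rewrite -(circle_arc v (c, false, out)) arcE.
by case: (out (+) _); rewrite eqxx ?orbT.
Qed.

Lemma near_edge v c x : (edge x \in circles_near v c) = (x \in circles_near v c).
Proof. by rewrite !circles_nearE -!eq_circle circle_edge. Qed.

Lemma near_arc v c x : (arc v x \in circles_near v c) = (x \in circles_near v c).
Proof. by rewrite !circles_nearE -!eq_circle circle_arc. Qed.

Lemma near_arc_flip v c x :
  x \in circles_near v c -> arc (flip_state v c) x \in circles_near v c.
Proof.
move=> hx; case: (eqVneq x.1.1 c) => [e|ne]; last by rewrite arc_flip ?near_arc.
by apply: ends_near; case: x e {hx} => [[i o] out] /=; rewrite arcE.
Qed.

(** Each of the two states keeps the union of the circles at c closed under the
    arcs of the other. *)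
Lemma near_flip v c : circles_near (flip_state v c) c = circles_near v c.
Proof.
suff sub w : circles_near (flip_state w c) c \subset circles_near w c.
  by apply/eqP; rewrite eqEsubset sub -{1}[v](flip_stateK c) sub.
apply/subsetP => x; rewrite circles_nearE.
suff h y : y.1.1 = c -> x \in circle (flip_state w c) y -> x \in circles_near w c.
  by case/orP; apply: h.
move=> yc; apply: (circle_sub (P := mem (circles_near w c))) => /=.
- by move=> z; rewrite near_edge.
- exact: near_arc_flip.
- exact: ends_near.
Qed.

Lemma circle_far v c x :
  x \notin circles_near v c -> circle (flip_state v c) x = circle v x.
Proof.
suff sub w : x \notin circles_near w c ->
    circle (flip_state w c) x \subset circle w x.
  move=> hx; apply/eqP; rewrite eqEsubset sub //.
  by rewrite -{1}[v](flip_stateK c) sub // near_flip.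
move=> hx; apply/subsetP => y hy.
suff /andP[] : (y \in circle w x) && (y \notin circles_near w c) by [].
apply: (circle_sub (P := fun y => (y \in circle w x) && (y \notin circles_near w c)))
  hy => [z|z|]; last by rewrite circle_id.
- by rewrite near_edge -!eq_circle circle_edge.
- move=> /andP[hz nz]; rewrite arc_flip.
    by rewrite near_arc nz -eq_circle circle_arc eq_circle hz.
  by apply: contraNneq nz => /ends_near.
Qed.

Section Parity.
Variable phi : passage D -> bool.
Hypothesis phi_next : forall u, phi (next_passage D u) = ~~ phi u.
Hypothesis phi_strand : forall c o, phi (c, ~~ o) = ~~ phi (c, o).

Lemma phi_edge x : phi (edge x).1 = ~~ phi x.1.
Proof.
case: x => u [] /=; first exact: phi_next.
by rewrite -{2}[u](permKV (next_passage D)) phi_next negbK.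
Qed.

Lemma phi_arc v x : phi (arc v x).1 = ~~ phi x.1.
Proof. by case: x => [[c o] out]; rewrite arcE /= phi_strand. Qed.

(** Every circle alternates between the two colours of [phi], and so is an
   orbit of [walk] on the darts of the colour k. *)
Definition walk_fun k v x := if phi x.1 == k then edge (arc v x) else x.

Lemma walk_fun_inj k v : injective (walk_fun k v).
Proof.
rewrite /walk_fun => x y.
case: (eqVneq (phi x.1)) => [hx | hx]; case: (eqVneq (phi y.1)) => [hy | hy] //.
- by move/(inv_inj (@edgeK D))/(inv_inj (arcK v)).
- by move=> h; move: hy; rewrite -h phi_edge phi_arc negbK hx eqxx.
- by move=> h; move: hx; rewrite h phi_edge phi_arc negbK hy eqxx.
Qed.

Definition walk k v : {perm dart D} := perm (@walk_fun_inj k v).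

Lemma circle_walk v x y :
  phi x.1 = phi y.1 -> (y \in circle v x) = (y \in porbit (walk (phi x.1) v) x).
Proof.
set k := phi x.1 => hy; apply/idP/idP; last first.
  case/porbitP => i ->; elim: i => [|i IH]; first by rewrite perm1 circle_id.
  rewrite expgSr permM permE /walk_fun; case: ifP => // _.
  by rewrite -eq_circle circle_edge circle_arc eq_circle.
pose P z := (if phi z.1 == k then z else edge z) \in porbit (walk k v) x.
have step z : (walk k v z \in porbit (walk k v) x) = (z \in porbit (walk k v) x).
  by rewrite -!eq_porbit_mem -[walk k v z]/((walk k v ^+ 1)%g z) porbit_perm.
have flipk z : (~~ phi z.1 == k) = ~~ (phi z.1 == k).
  by rewrite {1 2}/k; case: (phi z.1) (phi x.1) => [] [].
suff : y \in circle v x -> P y by rewrite /P -hy eqxx.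
apply: circle_sub => [z|z|]; rewrite /P.
- by rewrite phi_edge flipk; case: ifP => //=; rewrite edgeK.
- rewrite phi_arc flipk; case: ifP => /= hz.
    by rewrite -{1}step permE /walk_fun hz.
  by rewrite -(step (arc v z)) permE /walk_fun phi_arc flipk hz /= arcK.
- by rewrite eqxx porbit_id.
Qed.

Lemma walk_flip v c :
  walk (phi (c, true)) (flip_state v c)
  = (tperm (over_out c) (over_in c) * walk (phi (c, true)) v)%g.
Proof.
have wE k w z : walk k w z = walk_fun k w z by rewrite permE.
apply/permP => x; rewrite permM !wE /walk_fun.
case: (eqVneq x.1.1 c) => [xc | xc]; last first.
  by rewrite tpermD ?arc_flip //; apply: contraNneq xc => <-.
case: x xc => [[i o] out] /= ->; case: o.
  rewrite eqxx; case: out; rewrite ?tpermL ?tpermR /= eqxx !arcE flip_state_at.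
    by case: (v c) (positive D c) => [] [].
  by case: (v c) (positive D c) => [] [].
have e : phi (c, false) = ~~ phi (c, true) by rewrite -phi_strand.
by rewrite tpermD /over_out /over_in ?xpair_eqE ?andbF //= e; case: (phi (c, true)).
Qed.

(** A change of smoothing multiplies the permutation whose cycles are the circles
    by a transposition, and so either splits a circle or merges two. *)
Lemma separated_flip v c : separated (flip_state v c) c = ~~ separated v c.
Proof.
have sepE w : separated w c =
    (over_out c \notin porbit (walk (phi (c, true)) w) (over_in c)).
  by rewrite /separated eq_circle circle_walk // porbit_sym.
rewrite !sepE.
have := porbits_mul_tperm (walk (phi (c, true)) v) (over_out c) (over_in c).
have := porbits_mul_tperm (walk (phi (c, true)) (flip_state v c))
          (over_out c) (over_in c).
rewrite /= -!walk_flip flip_stateK.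
set m := #|_|; set n := #|_|.
have -> : over_out c != over_in c by rewrite !xpair_eqE andbF.
by case: (_ \notin _); case: (_ \notin _) => //=; lia.
Qed.

End Parity.
End Circles.
(** * Counting circles *)

Section Counting.
Variable D : gauss_code.
Implicit Types (c : 'I_(ncross D)) (x y : dart D).
Implicit Types (v : state D) (P Q : pred (dart D)).

Definition count_circles v P : nat := #|[set circle v x | x : dart D & P x]|.

Definition count_far v c P : nat :=
  count_circles v (fun x => P x && (x \notin circles_near v c)).

Lemma eq_count v P Q : P =1 Q -> count_circles v P = count_circles v Q.
Proof.
move=> e; congr #|pred_of_set _|; apply/setP => C.
by apply/imsetP/imsetP => [] [x Px ->]; exists x; rewrite // !inE (e, =^~ e) in Px *.
Qed.

Lemma labelling_op v (f : bool -> bool -> bool) P Q :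
  labelling v P -> labelling v Q -> labelling v (fun x => f (P x) (Q x)).
Proof. by move=> [e1 a1] [e2 a2]; split=> x; rewrite (e1, a1) (e2, a2). Qed.

Lemma labelling_op1 v (f : bool -> bool) P :
  labelling v P -> labelling v (fun x => f (P x)).
Proof. by move=> [e1 a1]; split=> x; rewrite (e1, a1). Qed.

Lemma mem_circles_with v P x : labelling v P ->
  (circle v x \in [set circle v y | y : dart D & P y]) = P x.
Proof.
move=> hP; apply/imsetP/idP => [[y]|Px]; last by exists x; rewrite ?inE.
rewrite inE => Py /eqP; rewrite eq_circle => xy.
by rewrite -(labelling_circle hP xy).
Qed.

Lemma count_circlesID v P Q : labelling v P -> labelling v Q ->
  count_circles v P =
  (count_circles v (fun x => P x && Q x) + count_circles v (fun x => P x && ~~ Q x))%N.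
Proof.
move=> hP hQ; set B := [set circle v x | x : dart D & Q x].
rewrite /count_circles -(cardsID B).
have hPQ f : labelling v (fun x => P x && f (Q x)).
  exact: (labelling_op (fun a b => a && f b) hP hQ).
congr (_ + _)%N; congr #|pred_of_set _|; apply/setP => C; rewrite !inE.
- apply/andP/imsetP => [[/imsetP[x Px ->]] | [x]].
    by rewrite mem_circles_with // => Qx; exists x; rewrite // !inE in Px *; rewrite Px.
  by rewrite inE => /andP[Px Qx] ->; rewrite !mem_circles_with.
- apply/andP/imsetP => [[nB /imsetP[x Px e]] | [x]].
    move: nB; rewrite e mem_circles_with // => Qx.
    by exists x; rewrite // !inE in Px *; rewrite Px.
  by rewrite inE => /andP[Px Qx] ->; rewrite !mem_circles_with.
Qed.

Lemma count_one_circle v P x : labelling v P ->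
  count_circles v (fun y => P y && (y \in circle v x)) = P x.
Proof.
move=> hP; rewrite /count_circles; case Px: (P x); last first.
  apply/eqP; rewrite cards_eq0; apply/eqP/setP => C; rewrite inE.
  apply/imsetP => -[y]; rewrite inE => /andP[Py yx] _.
  by rewrite (labelling_circle hP yx) Px in Py.
transitivity #|[set circle v x]|; last by rewrite cards1.
congr #|pred_of_set _|; apply/setP => C.
rewrite inE; apply/imsetP/eqP => [[y] | ->]; last first.
  by exists x; rewrite // inE Px circle_id.
by rewrite inE => /andP[_ yx] ->; apply: circle_eq.
Qed.

Lemma count_circles1 v P x : labelling v P ->
  count_circles v P = (count_circles v (fun y => P y && (y \notin circle v x)) + P x)%N.
Proof.
move=> hP; rewrite (count_circlesID hP (labelling_in_circle v x)) addnC.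
by congr (_ + _)%N; rewrite count_one_circle.
Qed.

Lemma count_joined v c P : labelling v P -> ~~ separated v c ->
  count_circles v P = (count_far v c P + P (over_out c))%N.
Proof.
move=> hP /negPn/eqP e; rewrite (count_circles1 (over_out c) hP).
congr (_ + _)%N; apply: eq_count => x.
by rewrite circles_nearE negb_or -e andbb.
Qed.

Lemma count_separated v c P : labelling v P -> separated v c ->
  count_circles v P = (count_far v c P + P (over_out c) + P (over_in c))%N.
Proof.
move=> hP s; rewrite (count_circles1 (over_out c) hP) addnAC; congr (_ + _)%N.
have hP' : labelling v (fun y => P y && (y \notin circle v (over_out c))).
  exact: (labelling_op (fun a b => a && ~~ b) hP (labelling_in_circle _ _)).
rewrite (count_circles1 (over_in c) hP').
have -> : over_in c \notin circle v (over_out c) by rewrite -eq_circle.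
rewrite andbT; congr (_ + _)%N; apply: eq_count => x.
by rewrite circles_nearE negb_or andbA.
Qed.

Lemma count_far_flip v c P Q :
  (forall x, x \notin circles_near v c -> P x = Q x) ->
  count_far (flip_state v c) c Q = count_far v c P.
Proof.
move=> h; rewrite /count_far /count_circles near_flip.
congr #|pred_of_set _|; apply/setP => C.
apply/imsetP/imsetP => [] [x]; rewrite inE => /andP[Px nx] ->.
  by exists x; rewrite ?circle_far // inE h // Px.
by exists x; rewrite ?circle_far // inE -h // Px.
Qed.

Lemma count_pos v P x : P x -> (0 < count_circles v P)%N.
Proof.
move=> Px; rewrite card_gt0; apply/set0Pn; exists (circle v x).
by apply: imset_f; rewrite inE.
Qed.

Lemma count_eq0 v P : count_circles v P = 0%N -> P =1 xpred0.
Proof. by move=> h x; apply/negP => /(count_pos v); rewrite h. Qed.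

Lemma count_all v P : labelling v P ->
  (count_circles v P + count_circles v (predC P))%N = count_circles v predT.
Proof. by move=> hP; rewrite (@count_circlesID v predT P). Qed.

(** The value at the sign vector Q of the monomial with a factor X for each
    circle in P. *)
Definition pairing v P Q : rat := (-1) ^+ count_circles v (fun x => P x && Q x).

Lemma pairingC v P Q : pairing v P Q = pairing v Q P.
Proof. by rewrite /pairing; congr (_ ^+ _); apply: eq_count => x; rewrite andbC. Qed.

Lemma eq_pairing v P P' Q Q' :
  P =1 P' -> Q =1 Q' -> pairing v P Q = pairing v P' Q'.
Proof.
by move=> e e'; rewrite /pairing; congr (_ ^+ _); apply: eq_count => x; rewrite e e'.
Qed.

Lemma pairingD v P P' Q : labelling v P -> labelling v P' -> labelling v Q ->
  pairing v (fun x => P x (+) P' x) Q = pairing v P Q * pairing v P' Q.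
Proof.
move=> hP hP' hQ; rewrite /pairing.
have lPQ := labelling_op andb hP hQ; have lP'Q := labelling_op andb hP' hQ.
have lD : labelling v (fun x => (P x (+) P' x) && Q x).
  by apply: (labelling_op andb _ hQ); apply: labelling_op.
rewrite (count_circlesID lD lPQ) (count_circlesID lPQ lP'Q) (count_circlesID lP'Q lPQ).
set n1 := count_circles _ _; set n2 := count_circles _ _; set n3 := count_circles _ _.
set n4 := count_circles _ _; set n5 := count_circles _ _; set n6 := count_circles _ _.
have -> : n1 = n4.
  by apply: eq_count => x; case: (P x) (P' x) (Q x) => [] [] [].
have -> : n2 = n6.
  by apply: eq_count => x; case: (P x) (P' x) (Q x) => [] [] [].
have -> : n5 = n3 by apply: eq_count => x; rewrite andbC.
by rewrite !exprD mulrACA -expr2 sqrr_sign mul1r.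
Qed.

Lemma pairing_circle v x Q : labelling v Q ->
  pairing v (mem (circle v x)) Q = (-1) ^+ Q x.
Proof.
move=> hQ; rewrite /pairing; congr (_ ^+ _).
by rewrite -(count_one_circle x hQ); apply: eq_count => y; rewrite andbC.
Qed.

Lemma pairing_sqr v P Q : pairing v P Q * pairing v P Q = 1.
Proof. by rewrite -expr2 sqrr_sign. Qed.

Lemma pairing_neq0 v P Q : pairing v P Q != 0.
Proof. by rewrite signr_eq0. Qed.

End Counting.

(** * The Fourier transform over the labellings *)

Section Fourier.
Variable D : gauss_code.
Implicit Types (c : 'I_(ncross D)) (x y : dart D) (v : state D).
Implicit Types s t u : generator D.
Local Notation chain := {ffun generator D -> rat}.
Implicit Types z w : chain.

Lemma glabelP s : labelling (gstate s) (glabel s).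
Proof. by apply/is_labellingP; rewrite -surjective_pairing; apply: valP. Qed.

Lemma generator_eq s t : gstate s = gstate t -> glabel s =1 glabel t -> s = t.
Proof.
move=> ev /ffunP el; apply: val_inj.
by rewrite [LHS]surjective_pairing [RHS]surjective_pairing; congr (_, _).
Qed.

Definition mkgen v (P : pred (dart D)) (hP : labelling v P) : generator D.
Proof.
exists (v, [ffun x => P x]); apply/is_labellingP.
by case: hP => e a; split=> x; rewrite !ffunE.
Defined.

Lemma mkgen_label v P (hP : labelling v P) : glabel (mkgen hP) =1 P.
Proof. by move=> x; rewrite /glabel /= ffunE. Qed.

Definition ones s : nat := count_circles (gstate s) (predC (glabel s)).

(** Multiplication by X on the circle through x. *)
Definition toggle x s : generator D :=
  mkgen (labelling_op addb (glabelP s) (labelling_in_circle (gstate s) x)).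

Lemma toggle_state x s : gstate (toggle x s) = gstate s.
Proof. by []. Qed.

Lemma toggle_label x s y :
  glabel (toggle x s) y = glabel s y (+) (y \in circle (gstate s) x).
Proof. by rewrite mkgen_label. Qed.

Lemma toggleK x : involutive (toggle x).
Proof. by move=> s; apply: generator_eq => // y; rewrite !toggle_label addbK. Qed.

(** The character table of the sign vectors, one block for each state. *)
Definition chi s t : rat :=
  if gstate s == gstate t then pairing (gstate s) (glabel s) (glabel t) else 0.

Lemma chiC s t : chi s t = chi t s.
Proof. by rewrite /chi eq_sym; case: eqP => // ->; rewrite pairingC. Qed.

Lemma chi_eq s t : gstate s = gstate t ->
  chi s t = pairing (gstate s) (glabel s) (glabel t).
Proof. by rewrite /chi => ->; rewrite eqxx. Qed.

Lemma chi_toggle x s t : chi (toggle x s) t = (-1) ^+ glabel t x * chi s t.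
Proof.
rewrite /chi toggle_state; case: eqP => [e|_]; last by rewrite mulr0.
have hs := glabelP s; have ht := glabelP t; rewrite -e in ht.
rewrite (eq_pairing (gstate s) (toggle_label x s) (frefl (glabel t))).
have hx := labelling_in_circle (gstate s) x.
by rewrite (pairingD hs hx ht) (pairing_circle x ht) mulrC.
Qed.

(** The squared length of a character at the state v. *)
Definition num_labellings v : rat := #|[set s : generator D | gstate s == v]|%:R.

Lemma num_labellings_neq0 s : num_labellings (gstate s) != 0.
Proof.
rewrite pnatr_eq0 -lt0n card_gt0; apply/set0Pn; exists s.
by rewrite inE.
Qed.

(** Toggling a circle on which s and u differ changes the sign of each term. *)
Lemma chi_orthogonal s u :
  \sum_t chi s t * chi t u = (s == u)%:R * num_labellings (gstate s).
Proof.
case: (eqVneq s u) => [<-|ne].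
  rewrite mul1r /num_labellings -sum1_card natr_sum [RHS]big_mkcond.
  apply: eq_bigr => t _; rewrite inE -(chiC s) /chi eq_sym.
  by case: eqP => [<-|_]; rewrite ?pairing_sqr ?mulr0.
rewrite mul0r; case: (eqVneq (gstate s) (gstate u)) => [e | nsu]; last first.
  apply: big1 => t _; rewrite /chi.
  case: eqP => [<-|_]; last by rewrite mul0r.
  by rewrite (negbTE nsu) mulr0.
have [x nx] : exists x, glabel s x != glabel u x.
  apply/existsP; apply: contraNT ne; rewrite negb_exists => /forallP h.
  by apply/eqP/generator_eq => // x; apply/eqP; rewrite -[_ == _]negbK.
set S := (X in X = 0); suff : S = - S.
  by move/eqP; rewrite -subr_eq0 opprK -mulr2n mulrn_eq0 => /eqP.
rewrite {1}/S (reindex_inj (inv_inj (toggleK x))) /= -sumrN.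
apply: eq_bigr => t _; rewrite chiC !chi_toggle (chiC t s) mulrACA.
have -> : (-1) ^+ glabel s x * (-1) ^+ glabel u x = -1 :> rat.
  by move: nx; case: (glabel s x) (glabel u x) => [] [].
by rewrite mulN1r.
Qed.

Definition fourier z : chain := [ffun t => \sum_s chi s t * z s].

Lemma fourierK z : fourier (fourier z) = [ffun s => num_labellings (gstate s) * z s].
Proof.
apply/ffunP => u; rewrite !ffunE.
under eq_bigr => t _ do rewrite ffunE big_distrr /=.
rewrite exchange_big /= (bigD1 u) //= [X in _ + X]big1 ?addr0.
  under eq_bigr => t _ do rewrite mulrA (mulrC (chi t u)).
  by rewrite -big_distrl /= chi_orthogonal eqxx mul1r.
move=> s ne; under eq_bigr => t _ do rewrite mulrA (mulrC (chi t u)).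
by rewrite -big_distrl /= chi_orthogonal (negbTE ne) !mul0r.
Qed.

Definition inv_fourier z : chain :=
  [ffun s => (num_labellings (gstate s))^-1 * fourier z s].

Lemma inv_fourierK z : fourier (inv_fourier z) = z.
Proof.
apply/ffunP => t; have /ffunP/(_ t) := fourierK z; rewrite !ffunE => h.
have -> : \sum_s chi s t * inv_fourier z s
        = (num_labellings (gstate t))^-1 * \sum_s chi s t * fourier z s.
  rewrite big_distrr; apply: eq_bigr => s _ /=; rewrite [inv_fourier z s]ffunE /chi.
  case: eqP => [->|_]; last by rewrite !mul0r mulr0.
  by rewrite mulrCA.
by rewrite h mulKf // num_labellings_neq0.
Qed.

Lemma fourier_inj : injective fourier.
Proof.
move=> z w /(congr1 fourier)/ffunP e; apply/ffunP => s.
have := e s; rewrite !fourierK !ffunE; apply: mulfI.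
exact: num_labellings_neq0.
Qed.

Lemma fourierD z w : fourier (z + w) = fourier z + fourier w.
Proof.
apply/ffunP => t; rewrite !ffunE -big_split; apply: eq_bigr => s _.
by rewrite ffunE mulrDr.
Qed.

Definition mulX x z : chain := [ffun s => z (toggle x s)].

Lemma fourier_mulX x z t : fourier (mulX x z) t = (-1) ^+ glabel t x * fourier z t.
Proof.
rewrite !ffunE (reindex_inj (inv_inj (toggleK x))) big_distrr.
by apply: eq_bigr => s _ /=; rewrite ffunE toggleK chi_toggle mulrA.
Qed.

End Fourier.
(** * Lee's differential after the Fourier transform *)

(** The default value t is taken only if the labels at c do not allow the other
   smoothing.  The constant is locked since comparing two such generators by
   conversion is slow. *)
HB.lock Definition flip (D : gauss_code) (c : 'I_(ncross D)) (t : generator D) :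
    generator D :=
  insubd t (flip_state (gstate t) c, glabel t).

Section LeeCube.
Variable D : gauss_code.
Variable phi : passage D -> bool.
Hypothesis phi_next : forall u, phi (next_passage D u) = ~~ phi u.
Hypothesis phi_strand : forall c o, phi (c, ~~ o) = ~~ phi (c, o).
Implicit Types (c : 'I_(ncross D)) (x y : dart D) (v : state D).
Implicit Types s t u : generator D.
Local Notation chain := {ffun generator D -> rat}.
Implicit Types z w g : chain.

Let sep_flip := separated_flip phi_next phi_strand.

(** The smoothing of a free crossing can be changed without changing labels. *)
Definition free c t : bool := glabel t (over_out c) == glabel t (over_in c).

Lemma near_label v c (P : pred (dart D)) x : labelling v P ->
  P (over_out c) = P (over_in c) -> x \in circles_near v c -> P x = P (over_out c).
Proof.
move=> hP e; rewrite circles_nearE => /orP[] h; rewrite (labelling_circle hP h) //.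
Qed.

Lemma labelling_flip v c (P : pred (dart D)) : labelling v P ->
  P (over_out c) = P (over_in c) -> labelling (flip_state v c) P.
Proof.
move=> hP e; split=> x; first by case: hP.
case: (eqVneq x.1.1 c) => [xc|xc]; last by rewrite arc_flip //; case: hP.
have hx := ends_near v xc.
by rewrite (near_label hP e hx) (near_label hP e (near_arc_flip hx)).
Qed.

Lemma joined_label v c (P : pred (dart D)) : labelling v P ->
  ~~ separated v c -> P (over_out c) = P (over_in c).
Proof.
by move=> hP /negPn; rewrite eq_circle => h; rewrite (labelling_circle hP h).
Qed.


Lemma flip_label c t : glabel (flip c t) = glabel t.
Proof. by rewrite /glabel flip.unlock val_insubd; case: ifP. Qed.

Lemma flip_gstate c t : free c t -> gstate (flip c t) = flip_state (gstate t) c.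
Proof.
move=> /eqP h; rewrite /gstate flip.unlock val_insubd.
by rewrite (introT (is_labellingP _ _)) //; apply: labelling_flip; first exact: glabelP.
Qed.

Lemma free_flip c c' t : free c (flip c' t) = free c t.
Proof. by rewrite /free flip_label. Qed.

Lemma flipK c t : free c t -> flip c (flip c t) = t.
Proof.
move=> h; apply: generator_eq => [|x]; last by rewrite !flip_label.
by rewrite !flip_gstate ?free_flip // flip_stateK.
Qed.

Lemma flipC c c' t : free c t -> free c' t -> flip c (flip c' t) = flip c' (flip c t).
Proof.
move=> h h'; apply: generator_eq => [|x]; last by rewrite 4!flip_label.
have hf : free c (flip c' t) by rewrite free_flip.
have hf' : free c' (flip c t) by rewrite free_flip.
rewrite (flip_gstate hf) (flip_gstate hf') (flip_gstate h) (flip_gstate h').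
by rewrite flip_stateC.
Qed.

Lemma cube_edgeE v c v' : cube_edge v c v' = ~~ v c && (v' == flip_state v c).
Proof.
rewrite /cube_edge; case vc: (v c) => //=.
have e i : v i (+) (i == c) = v i || (i == c).
  by case: eqP => [->|_]; rewrite ?vc ?addbF ?orbF.
apply/forallP/eqP => [h | -> i]; last by rewrite ffunE e.
by apply/ffunP => i; rewrite (eqP (h i)) ffunE e.
Qed.

Lemma cube_sign_flip v c c' :
  cube_sign (flip_state v c) c' = (-1) ^+ (c < c')%N * cube_sign v c'.
Proof.
rewrite /cube_sign; set A := [set i | _ & _]; set B := [set i | _ & _].
rewrite (cardsD1 c A) (cardsD1 c B).
have -> : A :\ c = B :\ c.
  apply/setP => i; rewrite !inE; case: eqP => //= /eqP ne.
  by rewrite flip_state_neq.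
rewrite !exprD mulrA; congr (_ * _); rewrite !inE flip_state_at.
by case: (c < c')%N (v c) => [] [].
Qed.

Lemma cube_sign_flip_at v c : cube_sign (flip_state v c) c = cube_sign v c.
Proof. by rewrite cube_sign_flip ltnn mul1r. Qed.

Lemma cube_sign_sqr v c : cube_sign v c * cube_sign v c = 1.
Proof. by rewrite /cube_sign -expr2 sqrr_sign. Qed.

(** Each square of the cube of resolutions anticommutes. *)
Lemma cube_sign_anticomm v c c' : c != c' ->
  cube_sign v c' * cube_sign (flip_state v c') c
  = - (cube_sign v c * cube_sign (flip_state v c) c').
Proof.
move=> ne; rewrite !cube_sign_flip.
have : (c : nat) != c' by [].
by case: ltngtP => // _ _ /=; ring.
Qed.

Lemma lee_localE c s t : lee_local c s t =
  [forall x, (x \in circles_near (gstate s) c) || (glabel t x == glabel s x)] &&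
  (if separated (gstate s) c
   then glabel t (over_out c) == glabel s (over_out c) (+) glabel s (over_in c)
   else glabel t (over_out c) (+) glabel t (over_in c) == ~~ glabel s (over_out c)).
Proof.
rewrite /lee_local /separated; congr (_ && _).
  by apply: eq_forallb => x; rewrite circles_nearE.
by case: eqP => _ /=; do ![case: (glabel _ _)].
Qed.

(** A merge multiplies functions on sign vectors by 1, and a split by X1 + X2,
   which is 2 or -2 on the diagonal and vanishes off the diagonal. *)
Definition kappa c t : rat :=
  if separated (gstate t) c then 2 * (-1) ^+ glabel t (over_out c) else 1.

Lemma chi_far c s t u : gstate s = flip_state (gstate t) c ->
  gstate u = gstate t ->
  (forall x, x \notin circles_near (gstate s) c -> glabel u x = glabel s x) ->
  count_far (gstate t) c (fun x => glabel t x && glabel u x) =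
  count_far (gstate s) c (fun x => glabel s x && glabel t x).
Proof.
move=> es eu h; rewrite -{1}[gstate t](flip_stateK c) -es.
by apply: count_far_flip => x nx; rewrite h // andbC.
Qed.

(** The comultiplication is multiplication by X1 + X2 on functions of the sign
    vectors; the two generators [tb] are the two terms of the comultiplication. *)
Lemma fourier_split c s t : gstate s = flip_state (gstate t) c ->
  separated (gstate t) c ->
  \sum_u chi t u * (lee_local c s u)%:R =
  if free c t then kappa c t * chi s (flip c t) else 0.
Proof.
move=> es sep.
have nsep : ~~ separated (gstate s) c by rewrite es sep_flip negbK.
have nears : circles_near (gstate s) c = circles_near (gstate t) c.
  by rewrite es near_flip.
pose lab (b : bool) x := if x \in circle (gstate t) (over_out c) then b else
  if x \in circle (gstate t) (over_in c) then b (+) ~~ glabel s (over_out c)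
  else glabel s x.
have lablab b : labelling (gstate t) (lab b).
  split=> x; rewrite /lab -!eq_circle (circle_edge, circle_arc) //.
    by case: (glabelP s) => ->.
  do 2![case: ifP => // ?].
  rewrite -[gstate t](flip_stateK c) -es arc_flip; first by case: (glabelP s).
  apply/negP => /eqP/(ends_near (gstate t)).
  rewrite circles_nearE -!eq_circle; apply/negP; rewrite negb_or.
  by apply/andP; split; apply/negbT.
pose tb b := mkgen (lablab b).
have tbo b : glabel (tb b) (over_out c) = b by rewrite mkgen_label /lab circle_id.
have tbi b : glabel (tb b) (over_in c) = b (+) ~~ glabel s (over_out c).
  by rewrite mkgen_label /lab circle_id -eq_circle ifN.
have tbf b x : x \notin circles_near (gstate s) c -> glabel (tb b) x = glabel s x.
  rewrite nears circles_nearE negb_or mkgen_label /lab.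
  by case/andP => /negbTE -> /negbTE ->.
have loc u : gstate u = gstate t ->
    lee_local c s u = (u == tb true) || (u == tb false).
  move=> eu; rewrite lee_localE (negbTE nsep).
  apply/andP/orP => [[/forallP hf /eqP ho] | h].
    suff eb : u = tb (glabel u (over_out c)).
      by case: (glabel u _) eb => ->; [left|right].
    apply: generator_eq => // x; rewrite mkgen_label /lab.
    have hu := glabelP u.
    case: ifP => [xo|xo]; first by apply: labelling_circle hu _; rewrite eu.
    case: ifP => [xi|xi].
      by rewrite -ho addKb; apply: labelling_circle hu _; rewrite eu.
    apply/eqP; have := hf x; rewrite nears circles_nearE xo xi; exact: id.
  have [b ->] : exists b, u = tb b by case: h => /eqP; [exists true | exists false].
  split; last by rewrite tbo tbi addKb.
  by apply/forallP => x; case: (boolP (_ \in _)) => //= /tbf ->.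
transitivity (chi t (tb true) + chi t (tb false)).
  rewrite (bigD1 (tb true)) //= (bigD1 (tb false)) /=; last first.
    by apply/eqP => /(congr1 (fun u => glabel u (over_out c))); rewrite !tbo.
  rewrite !loc // !eqxx orbT !mulr1 big1 ?addr0 // => u /andP[n1 n2].
  rewrite /chi; case: eqP => [e|]; last by rewrite mul0r.
  by rewrite loc // (negbTE n1) (negbTE n2) mulr0.
have lt := glabelP t.
have lb b : labelling (gstate t) (fun x => glabel t x && glabel (tb b) x).
  exact: (labelling_op andb lt (glabelP (tb b))).
rewrite (@chi_eq _ t (tb true)) // (@chi_eq _ t (tb false)) // /pairing.
rewrite (count_separated (lb true) sep) (count_separated (lb false) sep).
rewrite (chi_far es (erefl : gstate (tb true) = _) (tbf true)).
rewrite (chi_far es (erefl : gstate (tb false) = _) (tbf false)).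
rewrite !tbo !tbi; case: (boolP (free c t)) => [fr | nf]; last first.
  move: nf; rewrite /free !exprD; set M := _ ^+ count_far _ _ _.
  by case: (glabel t (over_out c)) (glabel t (over_in c)) (glabel s (over_out c))
    => [] [] [] //= _; ring.
have ls : labelling (gstate s) (glabel t).
  by rewrite es; apply: labelling_flip (eqP fr).
rewrite chi_eq ?flip_gstate // flip_label /pairing.
rewrite (count_joined (labelling_op andb (glabelP s) ls) nsep).
rewrite /kappa sep -(eqP fr) !exprD; set M := _ ^+ count_far _ _ _.
by case: (glabel t (over_out c)) (glabel s (over_out c)) => [] [] /=; ring.
Qed.

(** The multiplication restricts functions of the sign vectors to the diagonal. *)
Lemma fourier_merge c s t : gstate s = flip_state (gstate t) c ->
  ~~ separated (gstate t) c ->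
  \sum_u chi t u * (lee_local c s u)%:R =
  if free c t then kappa c t * chi s (flip c t) else 0.
Proof.
move=> es nsep.
have sep : separated (gstate s) c by rewrite es sep_flip.
have nears : circles_near (gstate s) c = circles_near (gstate t) c.
  by rewrite es near_flip.
have fr : free c t by apply/eqP; exact: joined_label (glabelP t) nsep.
pose b := glabel s (over_out c) (+) glabel s (over_in c).
pose lab x := if x \in circles_near (gstate t) c then b else glabel s x.
have lablab : labelling (gstate t) lab.
  split=> x; rewrite /lab (near_edge, near_arc).
    by case: (glabelP s) => ->.
  case: ifP => // h.
  rewrite -[gstate t](flip_stateK c) -es arc_flip; first by case: (glabelP s).
  by apply: contraFneq h => /(ends_near (gstate t)).
pose tb := mkgen lablab.
have tbo : glabel tb (over_out c) = b by rewrite mkgen_label /lab ends_near.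
have tbf x : x \notin circles_near (gstate s) c -> glabel tb x = glabel s x.
  by rewrite nears mkgen_label /lab => /negbTE ->.
have loc u : gstate u = gstate t -> lee_local c s u = (u == tb).
  move=> eu; rewrite lee_localE sep.
  apply/andP/eqP => [[/forallP hf /eqP ho] | ->]; last first.
    split; last by rewrite tbo.
    by apply/forallP => x; case: (boolP (_ \in _)) => //= /tbf ->.
  apply: generator_eq => // x; rewrite mkgen_label /lab.
  case: ifP => h; last by apply/eqP; have := hf x; rewrite nears h.
  have hu := glabelP u; rewrite eu in hu.
  by rewrite (near_label hu (joined_label hu nsep) h).
rewrite fr (bigD1 tb) //= loc // eqxx mulr1 big1 ?addr0; last first.
  move=> u n1; rewrite /chi; case: eqP => [e|]; last by rewrite mul0r.
  by rewrite loc // (negbTE n1) mulr0.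
have lt := glabelP t.
have lb : labelling (gstate t) (fun x => glabel t x && glabel tb x).
  exact: (labelling_op andb lt (glabelP tb)).
rewrite (@chi_eq _ t tb) // /pairing (count_joined lb nsep).
rewrite (chi_far es (erefl : gstate tb = _) tbf) tbo.
have ls : labelling (gstate s) (glabel t).
  by rewrite es; apply: labelling_flip (eqP fr).
rewrite chi_eq ?flip_gstate // flip_label /pairing.
rewrite (count_separated (labelling_op andb (glabelP s) ls) sep).
rewrite /kappa (negbTE nsep) mul1r -(eqP fr) !exprD /b.
set M := _ ^+ count_far _ _ _.
by case: (glabel t (over_out c)) (glabel s (over_out c)) (glabel s (over_in c))
  => [] [] [] /=; ring.
Qed.

Lemma fourier_lee z t : fourier (lee_d z) t =
  \sum_(c | gstate t c && free c t)
    cube_sign (gstate t) c * kappa c t * fourier z (flip c t).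
Proof.
rewrite ffunE.
transitivity (\sum_s \sum_(c | cube_edge (gstate s) c (gstate t))
    cube_sign (gstate s) c * z s * \sum_u chi t u * (lee_local c s u)%:R).
  under eq_bigr => u _ do rewrite ffunE big_distrr /=.
  rewrite exchange_big; apply: eq_bigr => s _.
  rewrite (eq_bigr (fun c => \sum_u
     cube_sign (gstate s) c * z s * (chi t u * (lee_local c s u)%:R))); last first.
    by move=> c _; rewrite big_distrr.
  rewrite exchange_big; apply: eq_bigr => u _ /=; rewrite (chiC u t).
  case: (eqVneq (gstate t) (gstate u)) => [e | ne]; last first.
    by rewrite /chi (negbTE ne) mul0r big1 // => c _; rewrite mul0r mulr0.
  rewrite /lee_coef -e big_distrl big_distrr; apply: eq_bigr => c _ /=; ring.
rewrite (exchange_big_dep (fun c => gstate t c)) /=; last first.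
  by move=> s c _; rewrite cube_edgeE => /andP[h /eqP ->]; rewrite flip_state_at.
rewrite big_mkcondr; apply: eq_bigr => c tc.
transitivity (\sum_(s | gstate s == flip_state (gstate t) c)
    cube_sign (gstate s) c * z s *
    (if free c t then kappa c t * chi s (flip c t) else 0)).
  apply: eq_big => [s | s].
    rewrite cube_edgeE; apply/andP/eqP => [[_ /eqP ->]|->].
      by rewrite flip_stateK.
    by rewrite flip_stateK flip_state_at tc.
  rewrite cube_edgeE => /andP[_ /eqP e].
  have es : gstate s = flip_state (gstate t) c by rewrite e flip_stateK.
  congr (_ * _); case: (boolP (separated (gstate t) c)) => h.
    exact: fourier_split.
  exact: fourier_merge.
case: ifP => [fr|_]; last by apply: big1 => s _; rewrite mulr0.
rewrite ffunE big_distrr /=.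
rewrite [RHS](bigID (fun s => gstate s == flip_state (gstate t) c)) /=.
rewrite [X in _ + X]big1 ?addr0; last first.
  by move=> s ns; rewrite /chi flip_gstate // (negbTE ns) mul0r mulr0.
apply: eq_bigr => s /eqP es.
rewrite es cube_sign_flip_at (chiC s); ring.
Qed.
(** The scalars [rho] trivialise the coefficients [kappa].  For each sign, the
   number of circles plus the number of 1-smoothings with this sign is unchanged by
   a merge and increased by 2 by a split, which accounts for the halves. *)
Definition rho_exponent (b : bool) t : nat :=
  (count_circles (gstate t) (fun x => glabel t x == b) +
   #|[set c | gstate t c && (glabel t (over_out c) == b)]|)%N.

Definition rho t : rat :=
  2 ^+ (rho_exponent false t)./2 * (- 2) ^+ (rho_exponent true t)./2.

Lemma rho_neq0 t : rho t != 0.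
Proof. by rewrite mulf_neq0 // expf_neq0. Qed.

Lemma rho_exponent_flip b c t : gstate t c -> free c t ->
  rho_exponent b t = (rho_exponent b (flip c t) +
    (separated (gstate t) c && (glabel t (over_out c) == b)).*2)%N.
Proof.
move=> tc fr; rewrite /rho_exponent flip_gstate // flip_label.
have lt : labelling (gstate t) (fun x => glabel t x == b).
  exact: (labelling_op1 (eq_op^~ b) (glabelP t)).
have lf : labelling (flip_state (gstate t) c) (fun x => glabel t x == b).
  by apply: (labelling_op1 (eq_op^~ b)); apply: labelling_flip (glabelP t) (eqP fr).
set A := [set i | _ & _]; set B := [set i | _ & _].
have cA : #|A| = (#|B| + (glabel t (over_out c) == b))%N.
  rewrite (cardsD1 c A) (cardsD1 c B) !inE flip_state_at tc /= add0n addnC.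
  congr (#|pred_of_set _| + _)%N; apply/setP => i; rewrite !inE.
  by case: eqP => //= /eqP ne; rewrite flip_state_neq.
have ff : count_far (flip_state (gstate t) c) c (fun x => glabel t x == b)
        = count_far (gstate t) c (fun x => glabel t x == b).
  exact: count_far_flip.
rewrite cA; case: (boolP (separated _ _)) => h.
  have h' : ~~ separated (flip_state (gstate t) c) c by rewrite sep_flip negbK.
  rewrite (count_separated lt h) (count_joined lf h') ff -(eqP fr).
  by case: (_ == b) => /=; lia.
have h' : separated (flip_state (gstate t) c) c by rewrite sep_flip.
rewrite (count_joined lt h) (count_separated lf h') ff -(eqP fr).
by case: (_ == b) => /=; lia.
Qed.

Lemma rho_flip c t : gstate t c -> free c t -> rho t = kappa c t * rho (flip c t).
Proof.
move=> tc fr; rewrite /rho /kappa.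
rewrite (rho_exponent_flip true tc fr) (rho_exponent_flip false tc fr).
move: (rho_exponent false _) (rho_exponent true _) => p q.
case: (separated _ _); last by rewrite !addn0 mul1r.
have h n : ((n + true.*2)./2 = n./2.+1)%N by rewrite addn2.
by case: (glabel t _); rewrite ?andTb ?eqxx ?h ?addn0 exprS; ring.
Qed.

Definition cube_d g : chain :=
  [ffun t => \sum_(c | gstate t c && free c t) cube_sign (gstate t) c * g (flip c t)].

Definition to_cube z : chain := [ffun t => fourier z t / rho t].

Definition of_cube g : chain := inv_fourier [ffun t => rho t * g t].

(** In the new coordinates Lee's complex is a sum of cubes, one for each
    colouring of the edges: the free crossings of the colouring are the directions
    of its cube. *)
Lemma to_cube_lee z : to_cube (lee_d z) = cube_d (to_cube z).
Proof.
apply/ffunP => t; rewrite [LHS]ffunE fourier_lee big_distrl [RHS]ffunE.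
apply: eq_bigr => c /andP[tc fr]; rewrite [to_cube _ _]ffunE (rho_flip tc fr).
rewrite /kappa; have r0 := rho_neq0 (flip c t).
case: separated => /=; last by rewrite mul1r mulr1 mulrA.
by case: (glabel t _) => /=; field.
Qed.

Lemma to_cube_inj : injective to_cube.
Proof.
move=> z w /ffunP e; apply: fourier_inj; apply/ffunP => t.
by have := e t; rewrite [LHS]ffunE [RHS]ffunE; apply: mulIf; rewrite invr_eq0 rho_neq0.
Qed.

Lemma of_cubeK g : to_cube (of_cube g) = g.
Proof.
apply/ffunP => t; rewrite ffunE inv_fourierK ffunE mulrC mulKf //.
exact: rho_neq0.
Qed.

Lemma to_cubeD z w : to_cube (z + w) = to_cube z + to_cube w.
Proof. have toE g t : to_cube g t = fourier g t / rho t by rewrite ffunE.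
apply/ffunP => t; rewrite [RHS]ffunE !toE fourierD.
by rewrite [X in X / _]ffunE mulrDl. Qed.

Lemma mulX_lee x z : mulX x (lee_d z) = lee_d (mulX x z).
Proof.
apply: fourier_inj; apply/ffunP => t; rewrite fourier_mulX !fourier_lee big_distrr.
by apply: eq_bigr => c _; rewrite fourier_mulX flip_label [LHS]mulrCA.
Qed.

(** A cube with a direction contracts along that direction; the chosen direction
    depends only on the colouring. *)
Definition contraction g : chain :=
  [ffun t => if [pick c | free c t] is Some c then
     if gstate t c then 0 else cube_sign (gstate t) c * g (flip c t)
   else 0].

Lemma pick_free_flip c t :
  [pick c' | free c' (flip c t)] = [pick c' | free c' t].
Proof. by apply: eq_pick => c'; rewrite free_flip. Qed.

Lemma contractionP g t c : free c t -> cube_d g = 0 ->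
  cube_d (contraction g) t = g t.
Proof.
move=> fc dg.
have [i fi pi] : exists2 i, free i t & [pick i | free i t] = Some i.
  by case: pickP => [i fi | /(_ c)]; [exists i | rewrite fc].
rewrite ffunE; case ti: (gstate t i).
  rewrite (bigD1 i) ?ti //= big1 ?addr0.
    rewrite ffunE pick_free_flip pi flip_gstate // flip_state_at ti /=.
    by rewrite cube_sign_flip_at mulrA cube_sign_sqr mul1r flipK.
  move=> j /andP[/andP[tj fj] ne]; rewrite ffunE pick_free_flip pi flip_gstate //.
  by rewrite flip_state_neq 1?eq_sym // ti mulr0.
(* Solve for g t in the equation that g is closed at the other end of the edge i. *)
have : cube_d g (flip i t) = 0 by rewrite dg ffunE.
rewrite ffunE.
rewrite (bigD1 i) /=; last by rewrite flip_gstate // flip_state_at ti free_flip fi.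
rewrite flipK // flip_gstate // cube_sign_flip_at => /eqP.
rewrite addr_eq0 => /eqP h.
have -> : g t = cube_sign (gstate t) i * (cube_sign (gstate t) i * g t).
  by rewrite mulrA cube_sign_sqr mul1r.
rewrite h -sumrN big_distrr /=; apply: eq_big => [j | j /andP[tj fj]].
  rewrite free_flip; case: (eqVneq j i) => [->|ne]; first by rewrite ti andbF.
  by rewrite flip_state_neq // andbT.
have ne : i != j by apply: contraFneq ti => ->.
rewrite ffunE pick_free_flip pi flip_gstate // flip_state_neq // ti.
by rewrite mulrA cube_sign_anticomm // flipC // mulrN mulrA mulNr.
Qed.

Lemma cube_d_isolated g t : (forall c, ~~ free c t) -> cube_d g t = 0.
Proof. by move=> h; rewrite ffunE big1 // => c; rewrite (negbTE (h c)) andbF. Qed.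

End LeeCube.
(** * Canonical cycles of a knot diagram *)

Section CanonicalCycles.
Variable D : gauss_code.
Variable phi : passage D -> bool.
Hypothesis phi_next : forall u, phi (next_passage D u) = ~~ phi u.
Hypothesis phi_strand : forall c o, phi (c, ~~ o) = ~~ phi (c, o).
Hypothesis one_component : #|porbits (next_passage D)| = 1%N.
Variable p : 'I_(ncross D).
Implicit Types (c : 'I_(ncross D)) (x y : dart D) (v : state D).
Implicit Types (u : passage D) (s t : generator D).
Local Notation chain := {ffun generator D -> rat}.
Implicit Types z w g : chain.

Local Notation ostate := (oriented_state D).

Let lee_cube := to_cube_lee phi_next phi_strand.

Lemma canonical_labelling b :
  labelling ostate (fun x => b (+) phi x.1 (+) x.2).
Proof.
split=> x.
  rewrite phi_edge //; case: x => u [] /=; case: b (phi u) => [] [] //.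
rewrite phi_arc //; case: x => [[c o] out]; rewrite arcE /= ffunE eqxx.
by case: b (phi _) out => [] [] [].
Qed.

(** These are the generators whose edges alternate between the two labels. *)
Definition canonical b : generator D := mkgen (canonical_labelling b).

Lemma canonical_label b x : glabel (canonical b) x = b (+) phi x.1 (+) x.2.
Proof. by rewrite mkgen_label. Qed.

Lemma canonical_not_free b c : ~~ free c (canonical b).
Proof. by rewrite /free !canonical_label /=; case: b (phi _) => [] []. Qed.

Lemma canonical_neq : canonical true != canonical false.
Proof.
apply/eqP => /(congr1 (fun t => glabel t (over_out p))).
by rewrite !canonical_label; case: (phi _).
Qed.

Lemma separated_oriented c : separated ostate c.
Proof.
apply: contraT => h; have := canonical_not_free true c.
by rewrite /free (joined_label (glabelP (canonical true)) h) eqxx.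
Qed.

(** If no crossing is free, then the labels change at every passage, and so
    alternate along the knot. *)
Lemma isolated_canonical t :
  (forall c, ~~ free c t) -> exists b, t = canonical b.
Proof.
move=> nf; have [le la] := glabelP t.
have straight u : glabel t (u, true) = ~~ glabel t (u, false).
  have ho c : glabel t (c, true, true) = ~~ glabel t (c, true, false).
    by have := nf c; rewrite /free; do 2!case: (glabel t _).
  case: u => c []; first exact: ho.
  rewrite -(la (c, false, true)) -(la (c, false, false)) !arcE /=.
  by case: (_ == _); rewrite /= ho ?negbK.
pose u0 : passage D := (p, true).
pose b := glabel t (u0, false) (+) phi u0.
have lab u : glabel t (u, false) = b (+) phi u.
  apply: (passage_ind one_component (u0 := u0)
            (P := fun u => glabel t (u, false) = b (+) phi u)) => [|w e].
    by rewrite addbK.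
  by rewrite -[(_, false)]/(edge (w, true)) le straight e phi_next addbN.
have labx x : glabel t x = b (+) phi x.1 (+) x.2.
  by case: x => u []; rewrite ?straight lab ?addbT ?addbF.
exists b; apply: generator_eq => [|x]; last by rewrite labx canonical_label.
apply/ffunP => c; rewrite ffunE.
have := la (over_out c); rewrite !labx phi_arc // arcE /=.
case: eqP => [-> //|_] /=.
by case: (b) (phi _) => [] [].
Qed.

Lemma labelling_predT v : labelling v predT.
Proof. by []. Qed.

Definition all_X v : generator D := mkgen (labelling_predT v).

Lemma all_X_label v x : glabel (all_X v) x.
Proof. by rewrite mkgen_label. Qed.

(** The canonical cycles, normalised to be 1 on the lowest generator. *)
Definition canonical_cycle b : chain :=
  [ffun s => chi (all_X ostate) (canonical b) * chi s (canonical b)].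

Lemma canonical_cycleE b s : gstate s = ostate ->
  canonical_cycle b s = pairing ostate (predC (glabel s)) (glabel (canonical b)).
Proof.
move=> es; rewrite ffunE !chi_eq // es.
have ls := glabelP s; rewrite es in ls.
rewrite -pairingD ?es //; last exact: glabelP (canonical b).
  by apply: eq_pairing => // x; rewrite /= all_X_label.
exact: glabelP (all_X ostate).
Qed.

Lemma canonical_cycle_out b s : gstate s != ostate -> canonical_cycle b s = 0.
Proof. by move=> ns; rewrite ffunE /chi (negbTE ns) mulr0. Qed.

(** The two canonical sign vectors are opposite, so that the monomials differ by
    one sign for each factor. *)
Lemma canonical_cycle_ones s : 
  canonical_cycle true s = (-1) ^+ ones s * canonical_cycle false s.
Proof.
case: (eqVneq (gstate s) ostate) => [es|ns]; last first.
  by rewrite !canonical_cycle_out ?mulr0.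
rewrite !canonical_cycleE // /pairing /ones es -exprD.
have ls : labelling ostate (predC (glabel s)).
  by rewrite -es; apply: (labelling_op1 negb); apply: glabelP.
rewrite [X in (X + _)%N](count_circlesID ls (glabelP (canonical false))).
set n1 := count_circles _ _; set n2 := count_circles _ _; set n3 := count_circles _ _.
have -> : n1 = n3.
  apply: eq_count => x; rewrite !canonical_label.
  by case: (predC _ _) (phi _) (x.2) => [] [] [].
by rewrite !exprD mulrAC -expr2 sqrr_sign mul1r.
Qed.

(** The homology classes in the basis of the sum and the difference of the two
   canonical cycles, which are supported on the generators with an even and an
   odd number of labels 1, respectively. *)
Definition cycle_comb (a b : rat) : chain :=
  [ffun s => a * (canonical_cycle false s + canonical_cycle true s) +
             b * (canonical_cycle false s - canonical_cycle true s)].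

Lemma cycle_combE a b s :
  cycle_comb a b s = 2 * (if odd (ones s) then b else a) * canonical_cycle false s.
Proof.
rewrite ffunE canonical_cycle_ones -signr_odd.
by case: (odd _); rewrite ?expr0 ?expr1; ring.
Qed.

Lemma to_cube_canonical b t :
  to_cube (canonical_cycle b) t =
  if t == canonical b
  then chi (all_X ostate) (canonical b) * num_labellings ostate / rho t else 0.
Proof.
rewrite ffunE [fourier _ _]ffunE.
under eq_bigr => s _ do rewrite ffunE mulrCA.
rewrite -big_distrr /=.
under eq_bigr => s _ do rewrite (chiC s t).
rewrite chi_orthogonal; case: eqP => [->|_]; last by rewrite mul0r mulr0 mul0r.
by rewrite mul1r.
Qed.

Lemma to_cube_comb a b t : to_cube (cycle_comb a b) t =
  a * (to_cube (canonical_cycle false) t + to_cube (canonical_cycle true) t) +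
  b * (to_cube (canonical_cycle false) t - to_cube (canonical_cycle true) t).
Proof.
rewrite ![to_cube _ t]ffunE.
have -> : fourier (cycle_comb a b) t =
    a * (fourier (canonical_cycle false) t + fourier (canonical_cycle true) t) +
    b * (fourier (canonical_cycle false) t - fourier (canonical_cycle true) t).
  rewrite ![fourier _ t]ffunE -big_split -sumrB !big_distrr -big_split.
  by apply: eq_bigr => s _ /=; rewrite [cycle_comb a b s]ffunE; ring.
by ring.
Qed.

Definition canonical_scale b : rat :=
  chi (all_X ostate) (canonical b) * num_labellings ostate / rho (canonical b).

Lemma canonical_scale_neq0 b : canonical_scale b != 0.
Proof.
rewrite /canonical_scale !mulf_neq0 ?invr_eq0 ?rho_neq0 //.
  by rewrite chi_eq // pairing_neq0.
exact: num_labellings_neq0 (canonical b).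
Qed.

Lemma to_cube_comb_at a b t :
  to_cube (cycle_comb a b) t =
  if t == canonical false then (a + b) * canonical_scale false
  else if t == canonical true then (a - b) * canonical_scale true else 0.
Proof.
rewrite to_cube_comb !to_cube_canonical /canonical_scale.
case: (eqVneq t (canonical false)) => [->|_].
  by rewrite eq_sym (negbTE canonical_neq); ring.
case: (eqVneq t (canonical true)) => [->|_]; ring.
Qed.

Lemma to_cube0 : to_cube (0 : chain) = 0.
Proof.
apply/ffunP => t; rewrite ffunE [fourier _ _]ffunE big1 ?mul0r ?ffunE // => s _.
by rewrite ffunE mulr0.
Qed.

Lemma cycle_comb_closed a b : lee_d (cycle_comb a b) = 0.
Proof.
apply: to_cube_inj; rewrite lee_cube to_cube0; apply/ffunP => t.
rewrite ffunE [RHS]ffunE big1 // => c /andP[_ fc].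
rewrite to_cube_comb_at.
do 2!(case: eqP => [e|_]; first by
  have := free_flip c c t; rewrite e fc (negbTE (canonical_not_free _ _))).
by rewrite mulr0.
Qed.

(** In cube coordinates boundaries vanish at the isolated generators. *)
Lemma cycle_comb_boundary a b w :
  cycle_comb a b = lee_d w -> a = 0 /\ b = 0.
Proof.
move=> e.
have h t : (forall c, ~~ free c t) -> to_cube (cycle_comb a b) t = 0.
  by move=> nf; rewrite e lee_cube cube_d_isolated.
have := h _ (canonical_not_free false); have := h _ (canonical_not_free true).
rewrite !to_cube_comb_at !eqxx (negbTE canonical_neq).
move=> /eqP; rewrite mulf_eq0 (negbTE (canonical_scale_neq0 _)) orbF => /eqP h1.
move=> /eqP; rewrite mulf_eq0 (negbTE (canonical_scale_neq0 _)) orbF => /eqP h2.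
by split; lra.
Qed.

(** Lee's theorem: every class is represented by the canonical cycles. *)
Lemma cycle_comb_span z : lee_d z = 0 ->
  exists a b w, z = cycle_comb a b + lee_d w.
Proof.
move=> dz; pose g := to_cube z.
have dg : cube_d g = 0.
  by rewrite -lee_cube dz to_cube0.
pose k b := g (canonical b) / canonical_scale b.
exists ((k false + k true) / 2), ((k false - k true) / 2).
exists (of_cube (contraction g)); apply: to_cube_inj.
apply/ffunP => t; rewrite to_cubeD lee_cube of_cubeK [RHS]ffunE to_cube_comb_at.
case: (boolP [exists c, free c t]) => [/existsP[c fc] | ].
  have ne b : (t == canonical b) = false.
    by apply/eqP => e; move: fc; rewrite e (negbTE (canonical_not_free _ _)).
  by rewrite !ne (contractionP fc dg) add0r.
rewrite negb_exists => /forallP nf; rewrite cube_d_isolated // addr0 -/g.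
have [b ->] := isolated_canonical nf.
have h0 := canonical_scale_neq0 b.
case: b h0 => h0; rewrite eqxx ?(negbTE canonical_neq) /k.
  set k0 := g (canonical false) / _.
  have -> : (k0 + g (canonical true) / canonical_scale true) / 2 -
     (k0 - g (canonical true) / canonical_scale true) / 2 =
     g (canonical true) / canonical_scale true by field.
  by rewrite divfK.
set k0 := g (canonical true) / _.
have -> : (g (canonical false) / canonical_scale false + k0) / 2 +
     (g (canonical false) / canonical_scale false - k0) / 2 =
     g (canonical false) / canonical_scale false by field.
by rewrite divfK.
Qed.

Lemma mulX_canonical x b s :
  canonical_cycle b (toggle x s) = (-1) ^+ glabel (canonical b) x * canonical_cycle b s.
Proof. by rewrite ffunE chi_toggle mulrCA [canonical_cycle b s]ffunE. Qed.

(** Multiplication by X acts on each canonical cycle as its sign at x, and these two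
    signs are opposite. *)
Lemma mulX_cycle_comb x a b :
  mulX x (cycle_comb a b) =
  cycle_comb ((-1) ^+ glabel (canonical false) x * b)
             ((-1) ^+ glabel (canonical false) x * a).
Proof.
apply/ffunP => s; rewrite ffunE ![cycle_comb _ _ _]ffunE !mulX_canonical.
have -> : glabel (canonical true) x = ~~ glabel (canonical false) x.
  by rewrite !canonical_label; case: (phi _) (x.2) => [] [].
rewrite signrN; move: (canonical_cycle false s) (canonical_cycle true s) => e f.
by move: ((-1) ^+ _) => r; ring.
Qed.

End CanonicalCycles.
(** * Gradings of homology classes *)

Section Gradings.
Variable D : gauss_code.
Implicit Types (c : 'I_(ncross D)) (x : dart D) (v : state D).
Implicit Types s t : generator D.
Local Notation chain := {ffun generator D -> rat}.
Implicit Types z w : chain.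
Implicit Types (M q : int).

Lemma lee_dD z w : lee_d (z + w) = lee_d z + lee_d w.
Proof.
apply/ffunP => t; rewrite !ffunE -big_split; apply: eq_bigr => s _.
by rewrite ffunE mulrDr.
Qed.

Lemma min_qdeg_exists z : z != 0 -> exists q, min_qdeg z q.
Proof.
move=> nz; have [s0 h0] : exists s, z s != 0.
  apply/existsP; apply: contraNT nz; rewrite negb_exists => /forallP h.
  by apply/eqP/ffunP => s; rewrite ffunE; apply/eqP; rewrite -[_ == _]negbK.
case: (arg_minP (P := fun s => z s != 0) (@qdeg D) h0) => s hs hmin.
by exists (qdeg s); split=> [|t /hmin //]; exists s.
Qed.

(** [low_class] bounds the grading of the class of z from above and [high_class]
    from below. *)
Definition low_class z M :=
  forall w, exists2 t, (z + lee_d w) t != 0 & qdeg t <= M.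

Definition high_class z M :=
  exists w, forall t, (z + lee_d w) t != 0 -> M <= qdeg t.

Lemma low_class_homologous z w M : low_class z M -> low_class (z + lee_d w) M.
Proof. by move=> h w'; rewrite -addrA -lee_dD; apply: h. Qed.

Lemma high_class_homologous z w M : high_class z M -> high_class (z + lee_d w) M.
Proof.
case=> w' h; exists (w' - w); rewrite -addrA -lee_dD.
by rewrite addrCA subrr addr0.
Qed.

Lemma low_class_le z M M' : M <= M' -> low_class z M -> low_class z M'.
Proof. by move=> le h w; have [t nt ht] := h w; exists t; last exact: le_trans le. Qed.

Lemma class_grading_le z M q : low_class z M -> class_grading z q -> q <= M.
Proof.
by move=> lo [[w [_ hq]] _]; have [t /hq h] := lo w; apply: le_trans.
Qed.

Lemma low_class_min z w M : low_class z M -> exists q, min_qdeg (z + lee_d w) q.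
Proof.
move=> lo; apply: min_qdeg_exists; apply/eqP => e.
by have [t] := lo w; rewrite e ffunE eqxx.
Qed.

Lemma class_grading_ge z M M' q :
  low_class z M' -> high_class z M -> class_grading z q -> M <= q.
Proof.
move=> lo [w hi] [_ hq]; have [q' hq'] := low_class_min w lo.
apply: le_trans (hq _ _ hq'); case: hq' => -[t nt <-] _; exact: hi.
Qed.

Lemma class_gradingP z M : low_class z M -> high_class z M -> class_grading z M.
Proof.
move=> lo [w hi]; split.
  exists w; split=> //; have [t nt ht] := lo w; exists t => //.
  by apply/eqP; rewrite eq_le ht hi.
by move=> w' q [_ hq]; have [t /hq h] := lo w'; apply: le_trans.
Qed.

Lemma qdegE s : qdeg s = 2 * (ones s)%:Z - (count_circles (gstate s) predT)%:Z
  + #|[set c | gstate s c]|%:Z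
  + #|[set c | positive D c]|%:Z - 2 * #|[set c | ~~ positive D c]|%:Z.
Proof.
rewrite -(count_all (glabelP s)) -/(ones s) /qdeg /ncircles_labelled.
rewrite -!/(count_circles _ _).
have -> : count_circles (gstate s) (fun x => glabel s x == false) = ones s.
  by apply: eq_count => x; rewrite eqbF_neg.
have -> : count_circles (gstate s) (fun x => glabel s x == true)
        = count_circles (gstate s) (glabel s).
  by apply: eq_count => x; rewrite eqb_id.
rewrite PoszD; ring.
Qed.

Lemma qdeg_toggle x s : qdeg (toggle x s) <= qdeg s + 2.
Proof.
rewrite !qdegE toggle_state.
have le : (ones (toggle x s) <= ones s + 1)%N.
  have l1 := labelling_op1 negb (glabelP s).
  have l2 := labelling_op1 negb (glabelP (toggle x s)).
  rewrite /ones (count_circles1 x l1) (count_circles1 x l2).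
  have -> : count_circles (gstate (toggle x s))
      (fun y => ~~ glabel (toggle x s) y && (y \notin circle (gstate (toggle x s)) x))
    = count_circles (gstate s) (fun y => ~~ glabel s y && (y \notin circle (gstate s) x)).
    apply: eq_count => y; rewrite toggle_label.
    by case: (y \in _); rewrite ?andbF ?addbF.
  by rewrite -addnA leq_add2l; do 2!case: (glabel _ x).
lia.
Qed.

Variable phi : passage D -> bool.
Hypothesis phi_next : forall u, phi (next_passage D u) = ~~ phi u.
Hypothesis phi_strand : forall c o, phi (c, ~~ o) = ~~ phi (c, o).

(** Multiplication by X lowers the filtration by at most 2. *)
Lemma low_class_mulX x z M : low_class (mulX x z) M -> low_class z (M + 2).
Proof.
move=> h w; have [t nt le] := h (mulX x w).
exists (toggle x t); last by apply: le_trans (qdeg_toggle _ _) _; rewrite lerD2r.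
apply: contraNN nt; rewrite -(mulX_lee phi_next phi_strand) => /eqP e.
by rewrite ffunE !ffunE in e *; rewrite e.
Qed.

(** Multiplication by X exchanges the two summands of the homology, so that
    their gradings differ by at most 2. *)
Lemma rasmussen_criterion (F : rat -> rat -> chain) x M :
  F 0 0 = 0 ->
  (forall z, lee_d z = 0 -> exists a b w, z = F a b + lee_d w) ->
  (forall a b, lee_d (F a b) = 0) ->
  (forall a b w, F a b = lee_d w -> a = 0 /\ b = 0) ->
  (forall a b, exists2 r, r != 0 & mulX x (F a b) = F (r * b) (r * a)) ->
  (forall a b, a != 0 -> low_class (F a b) M) ->
  (forall a b, high_class (F a b) M) ->
  (forall b, high_class (F 0 b) (M + 2)) ->
  is_rasmussen_invariant D (M + 1).
Proof.
move=> F0 span closed indep FX low high high0.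
have low2 a b : b != 0 -> low_class (F a b) (M + 2).
  move=> nb; have [r nr e] := FX a b; apply: (@low_class_mulX x).
  by rewrite e; apply: low; rewrite mulf_neq0.
have nz a b : (a != 0) || (b != 0) -> nonzero_class (F a b).
  move=> ab; split; first exact: closed.
  by case=> w /indep[a0 b0]; rewrite a0 b0 eqxx in ab.
split.
- exists (F 0 1); first by apply: nz; rewrite oner_eq0 orbT.
  rewrite -addrA; apply: class_gradingP; last exact: high0.
  by apply: low2; rewrite oner_eq0.
- exists (F 1 0); first by apply: nz; rewrite oner_eq0.
  by rewrite addrK; apply: class_gradingP; [apply: low; rewrite oner_eq0 | apply: high].
- move=> z q [dz ndz] gq; have [a [b [w e]]] := span z dz.
  have lo : low_class z (M + 2).
    rewrite e; apply: low_class_homologous; case: (eqVneq a 0) => [a0|na].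
      apply: low2; apply/eqP => b0; apply: ndz.
      by exists w; rewrite e a0 b0 F0 add0r.
    by apply: low_class_le (low a b na); rewrite lerDl.
  have hi : high_class z M by rewrite e; apply: high_class_homologous.
  rewrite addrK (class_grading_ge lo hi gq) -addrA.
  exact: class_grading_le lo gq.
Qed.

End Gradings.
(** * The genus of the Seifert surface *)

Section SeifertParity.
Variable D : gauss_code.
Implicit Types (u w : passage D) (x : dart D).

Definition swap_strands u : passage D := (u.1, ~~ u.2).

Lemma swap_strandsK : involutive swap_strands.
Proof. by case=> c o; rewrite /swap_strands /= negbK. Qed.

Definition swap_perm : {perm passage D} := perm (inv_inj swap_strandsK).

(** A Seifert circle follows the knot, changing strands at each crossing. *)
Definition seifert_perm : {perm passage D} := (swap_perm * next_passage D)%g.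

Lemma seifert_permE u :
  (seifert_perm u, false) = edge (arc (oriented_state D) (u, false)).
Proof.
by case: u => c o; rewrite permM permE arcE ffunE eqxx.
Qed.

Lemma circle_seifert u w :
  ((w, false) \in circle (oriented_state D) (u, false)) = (w \in porbit seifert_perm u).
Proof.
apply/idP/idP; last first.
  case/porbitP => i ->; elim: i => [|i IH]; first by rewrite perm1 circle_id.
  rewrite expgSr permM seifert_permE.
  by rewrite -eq_circle circle_edge circle_arc eq_circle.
pose P x := (if x.2 then (edge x).1 else x.1) \in porbit seifert_perm u.
have step u' : (seifert_perm u' \in porbit seifert_perm u) = (u' \in porbit seifert_perm u).
  rewrite -!eq_porbit_mem -[seifert_perm u']/((seifert_perm ^+ 1)%g u').
  by rewrite porbit_perm.
suff : (w, false) \in circle (oriented_state D) (u, false) -> P (w, false) by [].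
apply: circle_sub => [x|x|]; last exact: porbit_id.
- by rewrite /P; case: x => u' [] //=; rewrite permKV.
- have arcx b u' : arc (oriented_state D) (u', b) = (swap_perm u', ~~ b).
    by case: u' => c o; rewrite arcE ffunE eqxx permE addbT.
  case: x => u' []; rewrite /P arcx /=.
    by rewrite -(step (swap_perm u')) permM !permE swap_strandsK.
  by rewrite -(step u') permM.
Qed.

Lemma card_seifert_circles : #|porbits seifert_perm| = #|seifert_circles D|.
Proof.
pose g (C : {set dart D}) := [set u : passage D | (u, false) \in C].
have gE u : g (circle (oriented_state D) (u, false)) = porbit seifert_perm u.
  by apply/setP => w; rewrite inE circle_seifert.
have cE : seifert_circles D = [set circle (oriented_state D) (u, false) | u : passage D].
  apply/setP => C; apply/imsetP/imsetP => [] [x _ ->]; last by exists (x, false).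
  case: x => u []; last by exists u.
  by exists (next_passage D u); rewrite // -(circle_edge _ (u, true)).
have -> : porbits seifert_perm = g @: seifert_circles D.
  rewrite cE -imset_comp; apply: eq_imset => u /=.
  by rewrite gE.
apply: card_in_imset => C C'; rewrite cE => /imsetP[u _ ->] /imsetP[w _ ->].
rewrite !gE => e; apply/eqP; rewrite eq_circle circle_seifert e.
exact: porbit_id.
Qed.

Lemma card_porbits_swap : #|porbits swap_perm| = ncross D.
Proof.
have fst u w : w \in porbit swap_perm u -> w.1 = u.1.
  case/porbitP => i ->; elim: i => [|i IH]; first by rewrite perm1.
  by rewrite expgSr permM permE.
have -> : porbits swap_perm = [set porbit swap_perm (c, true) | c : 'I_(ncross D)].
  apply/setP => C; apply/imsetP/imsetP => [] [x _ ->]; last by exists (x, true).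
  case: x => c []; first by exists c.
  exists c => //; apply/eqP; rewrite eq_porbit_mem.
  have -> : (c, false) = (swap_perm ^+ 1)%g (c, true) by rewrite expg1 permE.
  exact: mem_porbit.
rewrite card_imset ?card_ord // => c c' e.
by have /fst : (c, true) \in porbit swap_perm (c', true) by rewrite -e porbit_id.
Qed.

(** The Seifert permutation is the product of the long cycle of the knot with
    one transposition for each crossing. *)
Lemma odd_seifert_circles : #|porbits (next_passage D)| = 1%N ->
  odd #|seifert_circles D| = ~~ odd (ncross D).
Proof.
move=> hK; have := odd_permM swap_perm (next_passage D).
rewrite -/seifert_perm /odd_perm card_seifert_circles card_porbits_swap hK.
rewrite card_prod card_ord card_bool muln2 odd_double /= => ->.
by rewrite addbT.
Qed.

(** The division by 2 in the genus is exact by parity. *)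
Lemma seifert_genusE : #|porbits (next_passage D)| = 1%N ->
  2 * seifert_genus D = 1 - #|seifert_circles D|%:Z + (ncross D)%:Z.
Proof.
move=> /odd_seifert_circles; rewrite /seifert_genus /seifert_euler.
move: #|seifert_circles D| => m; move: (ncross D) => n h.
have [k hk] : exists k : int, 1 - (m%:Z - n%:Z) = k * 2.
  exists ((n./2)%:Z - (m./2)%:Z + (n%:Z - (n./2)%:Z * 2)).
  have := odd_double_half m; have := odd_double_half n.
  by rewrite h; case: (odd n) => /=; lia.
rewrite hk mulzK //; lia.
Qed.

End SeifertParity.

(** * Almost positive diagrams *)

Section AlmostPositive.
Variable D : gauss_code.
Variable phi : passage D -> bool.
Hypothesis phi_next : forall u, phi (next_passage D u) = ~~ phi u.
Hypothesis phi_strand : forall c o, phi (c, ~~ o) = ~~ phi (c, o).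
Variable p : 'I_(ncross D).
Hypothesis almost_pos : almost_positive p.
Implicit Types (c : 'I_(ncross D)) (x : dart D) (v : state D).
Implicit Types s t : generator D.
Local Notation chain := {ffun generator D -> rat}.
Implicit Types z w : chain.

Local Notation ostate := (oriented_state D).
Local Notation cycle_comb := (cycle_comb phi_next phi_strand).
Let sep_flip := separated_flip phi_next phi_strand.

(** The all-0 state, the only one of homological degree -1. *)
Definition bottom : state D := [ffun=> false].

Lemma oriented_flip : ostate = flip_state bottom p.
Proof.
case: almost_pos => np pos; apply/ffunP => c; rewrite !ffunE.
by case: (eqVneq c p) => [->|/pos ->].
Qed.

(** The degree of the generator X...X of the oriented state. *)
Definition lowest : int := (ncross D)%:Z - #|seifert_circles D|%:Z - 2.

Lemma seifert_count : #|seifert_circles D| = count_circles ostate predT.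
Proof.
by congr #|pred_of_set _|; apply/setP => C; apply/imsetP/imsetP => [] [x _ ->]; exists x.
Qed.

Lemma count_flip c : (count_circles (flip_state bottom c) predT +
  (~~ separated (flip_state bottom c) c).*2)%N = #|seifert_circles D|.
Proof.
have tot i : (count_circles (flip_state bottom i) predT +
    (~~ separated (flip_state bottom i) i).*2 = count_circles bottom predT + 1)%N.
  have far := @count_far_flip D bottom i predT predT (fun _ _ => erefl).
  case: (boolP (separated (flip_state bottom i) i)) => h /=.
    have h' : ~~ separated bottom i by rewrite -sep_flip.
    rewrite (count_separated (labelling_predT _) h) (count_joined (labelling_predT _) h').
    by rewrite far addn0.
  have h' : separated bottom i by move: h; rewrite sep_flip negbK.
  rewrite (count_joined (labelling_predT _) h) (count_separated (labelling_predT _) h').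
  by rewrite far -!addnA.
rewrite tot -(tot p) -oriented_flip seifert_count.
by rewrite (separated_oriented phi_next phi_strand) addn0.
Qed.

(** Merging costs two circles in comparison with the oriented state, which
    raises the degree by 2. *)
Lemma qdeg_flip c t : gstate t = flip_state bottom c ->
  qdeg t = 2 * (ones t)%:Z + lowest + (if separated (gstate t) c then 0 else 2).
Proof.
move=> et; rewrite qdegE et /lowest -(count_flip c).
have -> : #|[set i | flip_state bottom c i]| = 1%N.
  rewrite -(cards1 c); congr #|pred_of_set _|; apply/setP => i.
  by rewrite !inE !ffunE.
case: almost_pos => np pos.
have nneg : #|[set i | ~~ positive D i]| = 1%N.
  rewrite -(cards1 p); congr #|pred_of_set _|; apply/setP => i.
  by rewrite !inE; case: (eqVneq i p) => [->|/pos ->].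
have npos : (#|[set i | positive D i]| + 1 = ncross D)%N.
  rewrite -nneg -[RHS]card_ord -cardsT -(cardsID [set i | positive D i] setT).
  by congr (_ + _)%N; congr #|pred_of_set _|; apply/setP => i; rewrite !inE ?andbT.
rewrite nneg; move: npos; case: separated => /=; lia.
Qed.

Lemma qdeg_oriented t : gstate t = ostate -> qdeg t = 2 * (ones t)%:Z + lowest.
Proof.
move=> e; have e' : gstate t = flip_state bottom p by rewrite e oriented_flip.
by rewrite (qdeg_flip e') e (separated_oriented phi_next phi_strand) addr0.
Qed.

Lemma cube_edge_flip c v c' :
  cube_edge v c' (flip_state bottom c) = (v == bottom) && (c' == c).
Proof.
rewrite cube_edgeE; apply/andP/andP => [[vc /eqP e] | [/eqP -> /eqP ->]]; last first.
  by rewrite ffunE.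
have cc : c' = c.
  apply/eqP; have := congr1 (fun f : state D => f c') e.
  by rewrite /= flip_state_at (negbTE vc) !ffunE.
rewrite cc in e *; split=> //; apply/eqP.
by rewrite -[v](flip_stateK c) /= -e flip_stateK.
Qed.

Lemma lee_d_flip c w t : gstate t = flip_state bottom c ->
  lee_d w t = \sum_(s | gstate s == bottom) (lee_local c s t)%:R * w s.
Proof.
move=> et; rewrite ffunE [RHS]big_mkcond; apply: eq_bigr => s _.
rewrite /lee_coef et; case: eqP => [es|ns].
  rewrite (big_pred1 c) => [|i]; last by rewrite cube_edge_flip es eqxx.
  congr (_ * _); rewrite /cube_sign es (_ : [set _ | _] = set0) ?cards0 ?mul1r //.
  by apply/setP => i; rewrite !inE ffunE andbF.
rewrite big_pred0 ?mul0r // => i; rewrite cube_edge_flip.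
by move/eqP/negbTE: ns => ->.
Qed.

Local Notation all_X := (all_X (D := D)).

Lemma ones_all_X v : ones (all_X v) = 0%N.
Proof.
apply/eqP; rewrite cards_eq0; apply/eqP/setP => C; rewrite inE.
by apply/imsetP => -[x]; rewrite inE /= all_X_label.
Qed.

Lemma ones_eq0 t : ones t = 0%N -> t = all_X (gstate t).
Proof.
move=> /count_eq0 h; apply: generator_eq => // x.
by rewrite all_X_label; have := h x => /= /negbFE.
Qed.

(** Two labels X are produced by splitting a label X only. *)
Lemma lee_d_all_X c w : separated (flip_state bottom c) c ->
  lee_d w (all_X (flip_state bottom c)) = w (all_X bottom).
Proof.
move=> sep; have nsep : ~~ separated bottom c by rewrite -sep_flip.
rewrite (@lee_d_flip c) // (bigD1 (all_X bottom)) //= big1 ?addr0.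
  rewrite lee_localE (negbTE nsep) !all_X_label andbT /=.
  rewrite (_ : [forall x, _] = true) ?mul1r //.
  by apply/forallP => x; rewrite !all_X_label orbT.
move=> s /andP[/eqP es ne].
rewrite lee_localE es (negbTE nsep) !all_X_label /=.
case: andP => [[/forallP hf /eqP/esym/negbFE ho]|_]; last by rewrite mul0r.
case/eqP: ne; apply: generator_eq => // x; rewrite all_X_label.
have ls := glabelP s; rewrite es in ls.
have := hf x; rewrite all_X_label; case/orP=> [nx | /eqP <- //].
by rewrite (near_label ls (joined_label ls nsep) nx).
Qed.

Lemma lee_d0 : lee_d (0 : chain) = 0.
Proof.
by apply/ffunP => t; rewrite !ffunE big1 // => s _; rewrite ffunE mulr0.
Qed.

Lemma canonical_cycle_neq0 b s : gstate s = ostate ->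
  canonical_cycle phi_next phi_strand b s != 0.
Proof. by move=> es; rewrite canonical_cycleE // pairing_neq0. Qed.

Lemma cycle_comb_out a b t : gstate t != ostate -> cycle_comb a b t = 0.
Proof. by move=> ne; rewrite cycle_combE canonical_cycle_out ?mulr0. Qed.

Lemma cycle_comb_high a b t : cycle_comb a b t != 0 -> lowest <= qdeg t.
Proof.
case: (eqVneq (gstate t) ostate) => [e _|ne]; last by rewrite cycle_comb_out ?eqxx.
by rewrite qdeg_oriented //; lia.
Qed.

Lemma high_class_comb a b : high_class (cycle_comb a b) lowest.
Proof. by exists 0 => t; rewrite lee_d0 addr0; apply: cycle_comb_high. Qed.

Lemma high_class_comb0 b : high_class (cycle_comb 0 b) (lowest + 2).
Proof.
exists 0 => t; rewrite lee_d0 addr0.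
case: (eqVneq (gstate t) ostate) => [e|ne]; last by rewrite cycle_comb_out ?eqxx.
rewrite qdeg_oriented // cycle_combE; case: (ones t) => [|k] /=.
  by rewrite mulr0 mul0r eqxx.
by move=> _; lia.
Qed.

(** ** A positive crossing parallel to the negative one *)

Lemma flip_bottom_neq c : c != p -> flip_state bottom c != ostate.
Proof.
move=> cp; rewrite oriented_flip; apply/eqP => /(congr1 (fun f : state D => f c)).
by rewrite !ffunE eqxx (negbTE cp).
Qed.

(** Only the lowest generator of the bottom state can cancel the lowest term of
    the cycle, but the parallel crossing splits the same circle and so produces
    another lowest term. *)
Lemma low_class_parallel c a b : c != p -> separated (flip_state bottom c) c ->
  a != 0 -> low_class (cycle_comb a b) lowest.
Proof.
move=> cp sep na w; have sepp := separated_oriented phi_next phi_strand p.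
case: (eqVneq (w (all_X bottom)) 0) => [w0 | nw].
  exists (all_X ostate); last by rewrite qdeg_oriented // ones_all_X; lia.
  rewrite ffunE; have -> : lee_d w (all_X ostate) = 0.
    by rewrite oriented_flip lee_d_all_X -?oriented_flip.
  by rewrite addr0 cycle_combE ones_all_X /= !mulf_neq0 ?canonical_cycle_neq0.
exists (all_X (flip_state bottom c)).
  by rewrite ffunE cycle_comb_out ?add0r ?lee_d_all_X // flip_bottom_neq.
by rewrite (@qdeg_flip c) // ones_all_X sep; lia.
Qed.

(** ** No positive crossing parallel to the negative one *)

Definition one_at x : generator D := toggle x (all_X ostate).

Lemma ones_one_at x : ones (one_at x) = 1%N.
Proof.
rewrite /ones -[RHS](count_one_circle x (labelling_predT (gstate (one_at x)))).
by apply: eq_count => y; rewrite /= toggle_label all_X_label negbK.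
Qed.

(** The comultiplication sends 1 to a symmetric sum, whereas the cycle has opposite
    coefficients at the two circles joined by the negative crossing. *)
Lemma low_class_not_parallel a b : b != 0 -> low_class (cycle_comb a b) (lowest + 2).
Proof.
move=> nb w.
have st : ostate = flip_state bottom p := oriented_flip.
pose tA := one_at (over_out p); pose tB := one_at (over_in p).
have dAB : lee_d w tA = lee_d w tB.
  rewrite !(@lee_d_flip p) //; apply: eq_bigr => s /eqP es; congr (_%:R * _).
  have nsep : ~~ separated bottom p.
    by rewrite -[~~ _]sep_flip -st (separated_oriented phi_next phi_strand).
  have far x : x \notin circles_near bottom p ->
      glabel tA x = true /\ glabel tB x = true.
    rewrite -(near_flip bottom p) -st circles_nearE negb_or => /andP[nA nB].
    by rewrite !toggle_label !all_X_label (negbTE nA) (negbTE nB).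
  have sp := separated_oriented phi_next phi_strand p.
  have [nAB nBA] : (over_in p \in circle ostate (over_out p)) = false /\
                   (over_out p \in circle ostate (over_in p)) = false.
    by split; apply/negbTE; rewrite -eq_circle // eq_sym.
  have tog x : glabel tA x = ~~ (x \in circle ostate (over_out p)) /\
               glabel tB x = ~~ (x \in circle ostate (over_in p)).
    by rewrite !toggle_label !all_X_label.
  rewrite !lee_localE es (negbTE nsep); congr (nat_of_bool (_ && _)).
    apply: eq_forallb => x; case: (boolP (x \in _)) => //= nx.
    by have [-> ->] := far x nx.
  have [-> ->] := tog (over_out p); have [-> ->] := tog (over_in p).
  by rewrite nAB nBA !circle_id.
have ZAB : cycle_comb a b tB = - cycle_comb a b tA.
  rewrite !cycle_combE !ones_one_at /= !mulX_canonical !canonical_label /=.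
  by case: (phi _) => /=; ring.
have ZA : cycle_comb a b tA != 0.
  by rewrite cycle_combE ones_one_at /= !mulf_neq0 ?canonical_cycle_neq0.
case: (eqVneq ((cycle_comb a b + lee_d w) tA) 0) => [eA|nA]; last first.
  by exists tA; rewrite // qdeg_oriented // ones_one_at; lia.
exists tB; last by rewrite qdeg_oriented // ones_one_at; lia.
rewrite ffunE in eA; rewrite ffunE ZAB -dAB; apply: contraNneq ZA => eB.
by apply/eqP; lra.
Qed.

Hypothesis not_parallel : forall c, c != p -> ~~ separated (flip_state bottom c) c.

(** A chain at the bottom state cancelling the lowest term of the cycle. *)
Definition correction a : chain :=
  [ffun s => if s == all_X bottom
     then - (2 * a * canonical_cycle phi_next phi_strand false (all_X ostate)) else 0].

Lemma lee_d_correction c a t : gstate t = flip_state bottom c ->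
  lee_d (correction a) t =
  (lee_local c (all_X bottom) t)%:R * correction a (all_X bottom).
Proof.
move=> et; rewrite (lee_d_flip _ et) (bigD1 (all_X bottom)) //= big1 ?addr0 //.
by move=> s /andP[_ ne]; rewrite ffunE (negbTE ne) mulr0.
Qed.

Lemma lee_d_correction_out a t :
  lee_d (correction a) t != 0 -> exists c, gstate t = flip_state bottom c.
Proof.
rewrite ffunE (bigD1 (all_X bottom)) //= [X in _ + X]big1 ?addr0; last first.
  by move=> s ne; rewrite ffunE (negbTE ne) mulr0.
case: (pickP (fun c => cube_edge bottom c (gstate t))) => [c|h].
  by rewrite cube_edgeE => /andP[_ /eqP e] _; exists c.
by rewrite /lee_coef big_pred0 // mul0r eqxx.
Qed.

(** Without parallel crossings every other crossing merges two circles labelled X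
    above the bottom state, which raises the degree by 4. *)
Lemma corrected_high a b t :
  (cycle_comb a b + lee_d (correction a)) t != 0 ->
  lowest + 2 + (if b == 0 then 2 else 0) <= qdeg t.
Proof.
have sp := separated_oriented phi_next phi_strand p.
rewrite ffunE; case: (eqVneq (gstate t) ostate) => [e|ne].
  have e' : gstate t = flip_state bottom p by rewrite e oriented_flip.
  rewrite qdeg_oriented // (lee_d_correction _ e').
  case o1: (ones t) => [|k].
    have tX : t = all_X ostate by rewrite -e; apply: ones_eq0.
    rewrite -(lee_d_correction _ e') tX [in X in _ + X]oriented_flip.
    rewrite lee_d_all_X -?oriented_flip // [X in _ + X]ffunE eqxx.
    by rewrite cycle_combE ones_all_X /= subrr eqxx.
  case: (eqVneq b 0) => [b0|_]; last by move=> _; lia.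
  case: k o1 => [|k] o1; last by move=> _; lia.
  rewrite cycle_combE o1 b0 /= mulr0 mul0r add0r.
  suff -> : lee_local p (all_X bottom) t = false by rewrite mul0r eqxx.
  have nsep : ~~ separated bottom p by rewrite -[~~ _]sep_flip -oriented_flip.
  rewrite lee_localE (negbTE nsep) all_X_label; apply/negbTE/negP.
  case/andP=> /forallP hf /eqP hab.
  have lt := glabelP t; rewrite e in lt.
  have l1 : labelling ostate (predC (glabel t)) by exact: (labelling_op1 negb lt).
  move: o1; rewrite /ones e (count_separated l1 sp) /=.
  move: hab; case ha: (glabel t (over_out p)); case hb: (glabel t (over_in p)) => //= _.
    have -> : count_far ostate p (predC (glabel t)) = 0%N; last by [].
    apply/eqP; rewrite cards_eq0; apply/eqP/setP => C; rewrite inE.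
    apply/imsetP => -[x]; rewrite inE /= => /andP[nt nx] _.
    have := hf x; rewrite all_X_label (negbTE nt) orbF.
    by rewrite -(near_flip bottom p) -oriented_flip (negbTE nx).
  by rewrite -addnA addnC.
rewrite cycle_comb_out // add0r => nz.
have [c ec] := lee_d_correction_out nz.
have cp : c != p by apply: contraNneq ne => cp; rewrite ec cp -oriented_flip.
have nsep := not_parallel cp.
rewrite (qdeg_flip ec) ec (negbTE nsep).
have : lee_local c (all_X bottom) t.
  by apply: contraNT nz => h; rewrite (lee_d_correction _ ec) (negbTE h) mul0r.
rewrite lee_localE !all_X_label.
have -> : separated bottom c by move: nsep; rewrite sep_flip negbK.
case/andP=> _ /eqP hc.
have : (0 < ones t)%N by apply: (@count_pos _ _ _ (over_out c)); rewrite /= hc.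
by case: (b == 0); lia.
Qed.

End AlmostPositive.

(** A crossing is parallel to the negative one exactly when it splits the
    circle that the bottom state makes out of the two Seifert circles. *)
Lemma parallel_separated (D : gauss_code) (phi : passage D -> bool)
    (phi_next : forall u, phi (next_passage D u) = ~~ phi u)
    (phi_strand : forall c o, phi (c, ~~ o) = ~~ phi (c, o)) p c :
  almost_positive p ->
  joins_same_seifert_circles c p <-> separated (flip_state (bottom D) c) c.
Proof.
move=> ap; have st := oriented_flip ap; set o := oriented_state D in st *.
have so i : separated o i := separated_oriented phi_next phi_strand i.
have sep_flip := separated_flip phi_next phi_strand.
have join : circle (bottom D) (over_out p) = circle (bottom D) (over_in p).
  by apply/eqP; rewrite -[_ == _]negbK -/(separated _ p) -sep_flip -st so.
have no : circles_near o p = circles_near (bottom D) p by rewrite st near_flip.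
have near x : (x \in circles_near o p) = (x \in circle (bottom D) (over_out p)).
  by rewrite no /circles_near -join setUid.
have inpair x : (circle o x \in circles_at o p) = (x \in circles_near o p).
  by rewrite in_set2 circles_nearE -!eq_circle ![circle o x == _]eq_sym.
rewrite sep_flip negbK; split=> [same|/eqP e].
  have mem x : circle o x \in circles_at o c -> x \in circle (bottom D) (over_out p).
    by rewrite same inpair near.
  have h1 : over_out c \in circle (bottom D) (over_out p).
    by apply: mem; rewrite in_set2 eqxx.
  have h2 : over_in c \in circle (bottom D) (over_out p).
    by apply: mem; rewrite in_set2 eqxx orbT.
  by rewrite (circle_eq h1) (circle_eq h2).
have h1 : over_out c \in circles_near o p.
  apply: contraT => nh; have := so c.
  have e0 : circle o (over_out c) = circle (bottom D) (over_out c).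
    by rewrite st; apply: circle_far; rewrite -no.
  by rewrite /separated eq_circle e0 e circle_id.
have h2 : over_in c \in circles_near o p.
  by move: h1; rewrite !near -!eq_circle e.
apply/eqP; rewrite eqEcard; apply/andP; split; last first.
  by rewrite /circles_at !cards2 -/(separated o c) -/(separated o p) !so.
by apply/subsetP => C; rewrite in_set2 => /orP[] /eqP ->; rewrite inpair.
Qed.

Theorem theorem3p5 (D : gauss_code) (p : 'I_(ncross D))
    (hD : knot_diagram D) (hp : almost_positive p) :
  (~ (exists c : 'I_(ncross D), positive D c /\ joins_same_seifert_circles c p) ->
     is_rasmussen_invariant D (2 * seifert_genus D)) /\
  ((exists c : 'I_(ncross D), positive D c /\ joins_same_seifert_circles c p) ->
     is_rasmussen_invariant D (2 * seifert_genus D - 2)).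
Proof.
have [phi [pn ps]] := gauss_parity hD.
have hK : #|porbits (next_passage D)| = 1%N by case: hD.
have hs (c : 'I_(ncross D)) : c != p -> positive D c by case: hp => _; apply.
have np : ~~ positive D p by case: hp.
pose Z := cycle_comb pn ps.
have X a b : exists2 r, r != 0 & mulX (over_out p) (Z a b) = Z (r * b) (r * a).
  by exists ((-1) ^+ glabel (canonical pn ps false) (over_out p));
    rewrite ?signr_eq0 // /Z mulX_cycle_comb.
have Z0 : Z 0 0 = 0 by apply/ffunP => s; rewrite !ffunE !mul0r addr0.
rewrite seifert_genusE //; split=> [npar | [c [pc same]]].
- have -> : 1 - #|seifert_circles D|%:Z + (ncross D)%:Z = lowest D + 2 + 1.
    by rewrite /lowest; lia.
  have nsep c : c != p -> ~~ separated (flip_state (bottom D) c) c.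
    move=> cp; apply/negP => /(parallel_separated pn ps c hp) same.
    by apply: npar; exists c; split; first exact: hs.
  apply: (rasmussen_criterion pn ps (F := fun a b => Z b a) (x := over_out p)) => //.
  + move=> z /(cycle_comb_span pn ps hK p)[a [b [w ->]]].
    by exists b, a, w.
  + by move=> a b; apply: (cycle_comb_closed pn ps p).
  + by move=> a b w /(cycle_comb_boundary p)[-> ->].
  + by move=> a b nz; apply: (low_class_not_parallel pn ps hp).
  + move=> a b; exists (correction pn ps b) => t /(corrected_high hp nsep).
    by apply: le_trans; case: eqP => _; lia.
  + move=> b; exists (correction pn ps b) => t /(corrected_high hp nsep).
    by rewrite eqxx.
- have -> : 1 - #|seifert_circles D|%:Z + (ncross D)%:Z - 2 = lowest D + 1.
    by rewrite /lowest; lia.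
  have cp : c != p by apply: contraNneq np => <-.
  have sep := (parallel_separated pn ps c hp).1 same.
  apply: (rasmussen_criterion pn ps (F := Z) (x := over_out p)) => //.
  + exact: (cycle_comb_span pn ps hK p).
  + by move=> a b; apply: (cycle_comb_closed pn ps p).
  + exact: (cycle_comb_boundary p).
  + by move=> a b; apply: (low_class_parallel pn ps hp b cp sep).
  + exact: (high_class_comb pn ps hp).
  + exact: (high_class_comb0 pn ps hp).
Qed.
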